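(* Let $n\in\{2,3\}$. There is an absolute constant $C>0$ such that the following holds. Let $p$ be a prime, let $\{\omega_1,\ldots,\omega_n\}$ be a basis of $\mathbb{F}_{p^n}$ over $\mathbb{F}_p$, let $N_1,\dots,N_n$ be integers, and let $H_1,\dots,H_n$ be integers with $1\le H_1\le\ldots\le H_n<\sqrt{p/2}$. Put $$B=\left\{\sum_{i=1}^n x_i\omega_i : x_i\in\mathbb{Z},\ N_i+1\le x_i\le N_i+H_i,\ 1\le i\le n\right\}\subseteq\mathbb{F}_{p^n}.$$ Then the multiplicative energy $$E(B)=\#\{(x,y,w,t)\in B^4 : xy=wt\}$$ satisfies $$E(B)\le C\,|B|^2(\log p)^3.$$
   Context: $\mathbb{F}_{p^n}$ is the finite field of order $p^n$. Integers $x_i$ act on $\mathbb{F}_{p^n}$ through their residues modulo $p$, so $|B|=\prod_{i=1}^n H_i$. *)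

(* Defs.v *)
From HB Require Import structures.
From mathcomp Require Import all_boot all_order all_algebra all_field.
From mathcomp Require Import boolp reals exp.

Set Implicit Arguments.
Unset Strict Implicit.
Unset Printing Implicit Defensive.
Import Order.TTheory GRing.Theory Num.Theory.
Local Open Scope ring_scope.

(* [pPrimeCharType] is the carrier of F with its canonical structure of vector
   space over 'F_p, in which k%:R *: z = z *+ k. *)
Definition Fp_basis (F : finFieldType) (p n : nat) (hp : prime p)
    (hF : #|F| = (p ^ n)%N) (w : n.-tuple F) : bool :=
  basis_of {: pPrimeCharType (card_finPcharP hF hp)} w.

Definition box (F : finFieldType) (n : nat) (w : n.-tuple F)
    (N H : 'I_n -> int) : {set F} :=
  [set z : F | `[< exists x : 'I_n -> int,
      (forall i, N i + 1 <= x i <= N i + H i) /\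
      z = \sum_(i < n) tnth w i *~ x i >]].

Definition mul_energy (F : finFieldType) (B : {set F}) : nat :=
  #|[set q : F * F * F * F | let: (x, y, w, t) := q in
      [&& x \in B, y \in B, w \in B, t \in B & x * y == w * t]]|.

(* Main.v *)
Require Import Defs.
From mathcomp Require Import all_boot all_order all_algebra all_field.
From mathcomp Require Import boolp reals exp trigo.
From mathcomp Require Import zify ring lra.
Set Implicit Arguments.
Unset Strict Implicit.
Unset Printing Implicit Defensive.
Import Order.TTheory GRing.Theory Num.Theory.
Local Open Scope ring_scope.

(* For a ratio [z] let [S_z] be the set of nonzero [y] in the box [B] with
   [z * y] in [B]. The energy is at most [3 |B|^2 + sum_z |S_z|^2], while
   [sum_z |S_z| <= |B|^2], so only those [z] with [|S_z|] large matter.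

   The integer coordinates of the pairs [(z y, y)], [y] in [S_z], lie in a
   translate of a lattice of rank [2n] and index [p ^ n]. Let [2^-j] be the
   dyadic scale of the shortest difference of two of them, relative to the box.
   - Such a difference determines [z], which bounds the number of [z] at level
     [j] by the number of pairs of points of the box shrunk by [2 ^ j].
   - If the differences span a space of dimension at most [n], then
     [|S_z| = O(2 ^ (j n))], because an [s]-dimensional set without small
     differences is controlled by [s] of its coordinates.
   - If they span more than [n] dimensions, orthogonality of characters (at most
     [4 p^n / |S_z|] functionals are small on all of [S_z]) and the pigeonhole
     principle give many vectors of the dual lattice in the dual box, of sides
     [p / (16 n H_i)]. Being orthogonal to the differences, these span fewer than
     [n] dimensions, so the same count applies to them at their own level.
   When [2 ^ j] exceeds the smaller sides of the box the count of [z] is too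
   weak. Then [z] lies in the prime field, or [n = 3] and the short vectors avoid
   the first basis vector; in both cases [2 H_i^2 < p] makes the corresponding
   2x2 minors vanish, so the relevant sublattice has rank one.

   Each of the [O(log p)] levels contributes [O(|B|^2)]. *)

(** * Columns that dominate a row space *)

(** Choose the maximal minor of largest absolute value. By Cramer's rule every column is a
    combination of the chosen ones, with quotients of maximal minors by this one as coefficients,
    hence at most 1 in absolute value. *)
Lemma row_free_dominating_cols (K : realFieldType) (s d : nat)
    (A : 'M[K]_(s, d)) :
  row_free A -> exists f : 'I_s -> 'I_d, forall v : 'rV[K]_d, (v <= A)%MS ->
    forall i, `|v 0 i| <= \sum_(l < s) `|v 0 (f l)|.
Proof.
move=> freeA.
have fullA : row_full A^T by rewrite -col_leq_rank mxrank_tr row_leq_rank.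
pose f1 : {ffun 'I_s -> 'I_d} := fullrankfun fullA.
pose g (f : {ffun 'I_s -> 'I_d}) := `|\det (colsub f A)|.
have [f _ fmax] := @arg_maxP _ _ _ f1 xpredT g isT.
have gf_gt0 : 0 < g f.
  apply: lt_le_trans (fmax f1 isT).
  rewrite normr_gt0 -unitfE -[_ \is a _]unitmxE -row_full_unit.
  have := mxrank_fullrowsub fullA; rewrite /row_full.
  rewrite (_ : rowsub _ _ = (colsub f1 A)^T) ?mxrank_tr; first by move->.
  by apply/matrixP=> i j; rewrite !mxE.
set D := colsub f A; have Dunit : D \in unitmx.
  by rewrite unitmxE unitfE -normr_gt0.
exists f => v /submxP[u ->] i.
pose y := invmx D *m col i A.
have y_le1 l : `|y l 0| <= 1.
  pose f' := [ffun l' => if l' == l then i else f l'].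
  have -> : y l 0 = (\det D)^-1 * \det (colsub f' A).
    rewrite /y /invmx Dunit -scalemxAl mxE; congr (_ * _).
    rewrite (expand_det_col _ l) mxE; apply: eq_bigr => k _.
    rewrite !mxE ffunE eqxx mulrC; congr (_ * (_ * \det _)).
    apply/matrixP=> a b; rewrite !mxE ffunE.
    by rewrite eq_sym (negbTE (neq_lift _ _)).
  rewrite normrM normfV ler_pdivrMl ?mulr1 //.
  exact: fmax.
have -> : (u *m A) 0 i = \sum_l (u *m A) 0 (f l) * y l 0.
  transitivity ((u *m D *m y) 0 0).
    by rewrite -mulmxA mulKVmx // !mxE; apply: eq_bigr => k _; rewrite !mxE.
  rewrite mxE; apply: eq_bigr => l _; congr (_ * _).
  by rewrite !mxE; apply: eq_bigr => k _; rewrite !mxE.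
apply: le_trans (ler_norm_sum _ _ _) _; apply: ler_sum => l _.
by rewrite normrM ler_piMr.
Qed.

(** Scaling column [i] by [1 / h i] absorbs the weights; passing to a row basis removes the freeness
    assumption and makes [r] the rank. *)
Lemma dominating_cols (K : realFieldType) (s d : nat) (A : 'M[K]_(s, d))
    (h : 'I_d -> K) :
  (forall i, 0 < h i) ->
  exists r (f : 'I_r -> 'I_d), (r <= s)%N /\
    forall v : 'rV[K]_d, (v <= A)%MS ->
    forall i, `|v 0 i| / h i <= \sum_(l < r) `|v 0 (f l)| / h (f l).
Proof.
move=> h_gt0; pose E := diag_mx (\row_i (h i)^-1).
have EE (v : 'rV_d) i : (v *m E) 0 i = v 0 i / h i.
  by rewrite mul_mx_diag !mxE.
have [f fP] := row_free_dominating_cols (row_base_free (A *m E)).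
exists (\rank (A *m E)), f; split; first exact: rank_leq_row.
move=> v vA i; have vE := fP (v *m E); have := vE _ i.
have nE j : `|(v *m E) 0 j| = `|v 0 j| / h j.
  by rewrite EE normrM (gtr0_norm (_ : 0 < (h j)^-1)) // invr_gt0.
rewrite nE; under eq_bigr do rewrite nE; apply.
by rewrite eq_row_base submxMr.
Qed.

(** * Point sets without small differences *)

Definition bounded_on (T : finType) d (h : 'I_d -> nat)
    (X : T -> 'rV[int]_d) (S : {set T}) : Prop :=
  forall x y, x \in S -> y \in S -> forall i, (`|X x 0%R i - X y 0%R i| <= h i)%N.

Definition separated_on (T : finType) d (h : 'I_d -> nat)
    (X : T -> 'rV[int]_d) (S : {set T}) (k : nat) : Prop :=
  forall x y, x \in S -> y \in S ->
    (forall i, (k * `|X x 0%R i - X y 0%R i| <= h i)%N) -> x = y.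

Lemma bounded_onS (T : finType) d (h : 'I_d -> nat) (X : T -> 'rV[int]_d)
    (S S' : {set T}) :
  S' \subset S -> bounded_on h X S -> bounded_on h X S'.
Proof. by move=> /subsetP sS b x y /sS xS /sS yS; apply: b. Qed.

Lemma separated_onS (T : finType) d (h : 'I_d -> nat) (X : T -> 'rV[int]_d)
    (S S' : {set T}) k :
  S' \subset S -> separated_on h X S k -> separated_on h X S' k.
Proof. by move=> /subsetP sS b x y /sS xS /sS yS; apply: b. Qed.

Definition diffQ (T : finType) d (X : T -> 'rV[int]_d) (x y : T) : 'rV[rat]_d :=
  map_mx intr (X x - X y).

Lemma diffQE (T : finType) d (X : T -> 'rV[int]_d) x y i :
  `|diffQ X x y 0 i| = (`|X x 0%R i - X y 0%R i|%N)%:R.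
Proof. by rewrite !mxE -intr_norm -natr_absz. Qed.

Lemma divn_eq_distn (a b m h : nat) :
  (0 < h)%N -> (a * m %/ h = b * m %/ h)%N ->
  (`|a%:Z - b%:Z| * m <= h)%N.
Proof.
move=> h_gt0 e.
have ea := divn_eq (a * m) h; have eb := divn_eq (b * m) h.
have la := ltn_pmod (a * m) h_gt0; have lb := ltn_pmod (b * m) h_gt0.
rewrite e in ea; move: la lb ea eb.
move: (_ %% h)%N (_ %% h)%N (_ %/ h)%N => r r' q.
have -> : (`|a%:Z - b%:Z| * m = `|(a * m)%:Z - (b * m)%:Z|)%N.
  by rewrite !PoszM -mulrBl abszM.
by lia.
Qed.

(** Cut the range of each dominating coordinate into cells of length [h / (s * k)]. Two points in
    the same cells differ by at most [h i / k] in every coordinate [i], since at most [s]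
    coordinates dominate; so they coincide. *)
Lemma card_separated_pos (T : finType) d s k (h : 'I_d -> nat)
    (X : T -> 'rV[int]_d) (S : {set T}) (A : 'M[rat]_(s, d)) :
  (0 < k)%N -> (forall i, 0 < h i)%N ->
  bounded_on h X S -> separated_on h X S k ->
  (forall x y, x \in S -> y \in S -> (diffQ X x y <= A)%MS) ->
  (#|S| <= (2 * s * k).+1 ^ s)%N.
Proof.
move=> k_gt0 h_gt0 bS sS rS.
have [->|[x0 x0S]] := set_0Vmem S; first by rewrite cards0.
have hQ_gt0 i : 0 < (h i)%:R :> rat by rewrite ltr0n.
have [r [f [rs dom]]] := dominating_cols A hQ_gt0.
(* The shift by [h] puts coordinates in [[0, 2h]], so the cell number is a natural quotient between
   0 and [2 * s * k]. *)
pose a x l := absz (X x 0 (f l) - X x0 0 (f l) + (h (f l))%:Z).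
pose cell x := [ffun l => inord (a x l * (s * k) %/ h (f l)) : 'I_(2 * s * k).+1].
have aE x l : x \in S -> (a x l)%:Z = X x 0%R (f l) - X x0 0%R (f l) + (h (f l))%:Z.
  by move=> xS; rewrite /a; have := bS _ _ xS x0S (f l); lia.
have a_lt x l : x \in S -> (a x l * (s * k) %/ h (f l) < (2 * s * k).+1)%N.
  move=> xS; rewrite ltnS -[leqRHS](mulnK _ (h_gt0 (f l))) leq_div2r //.
  have : (a x l <= 2 * h (f l))%N.
    by rewrite /a; have := bS _ _ xS x0S (f l); lia.
  have -> : (2 * s * k * h (f l) = 2 * h (f l) * (s * k))%N by ring.
  by move=> le2; rewrite leq_mul.
have cell_inj : {in S &, injective cell}.
  move=> u v uS vS /ffunP exy; apply: sS => // i.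
  have le_l l : (`|X u 0%R (f l) - X v 0%R (f l)| * (s * k) <= h (f l))%N.
    have := exy l; rewrite !ffunE => /(congr1 val) /=.
    rewrite !inordK ?a_lt // => /(divn_eq_distn (h_gt0 _)).
    by rewrite !aE //; congr (`|_| * _ <= _)%N; lia.
  have := dom _ (rS _ _ uS vS) i.
  rewrite diffQE ler_pdivrMr // => le_i.
  suff : (k%:R * (`|X u 0%R i - X v 0%R i|%N)%:R <= (h i)%:R :> rat).
    by rewrite -natrM ler_nat.
  have [r0|r_gt0] := posnP r.
    move: le_i; rewrite big1 ?mul0r => [|[l ll] _]; last by exfalso; rewrite r0 in ll.
    by move=> le_i; apply: le_trans (ler0n _ _); rewrite pmulr_rle0 // ltr0n.
  have s_gt0 : (0 < s)%N by apply: leq_trans rs.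
  have sk_gt0 : 0 < (s * k)%:R :> rat by rewrite ltr0n muln_gt0 s_gt0.
  have : \sum_(l < r) `|diffQ X u v 0 (f l)| / (h (f l))%:R <= k%:R^-1.
    apply: (@le_trans _ _ (\sum_(l < r) (s * k)%:R^-1)).
      apply: ler_sum => l _; rewrite diffQE ler_pdivrMr //.
      rewrite mulrC ler_pdivlMr // -natrM ler_nat; exact: le_l.
    rewrite sumr_const card_ord -[_ *+ r]mulr_natl ler_pdivrMr //.
    rewrite natrM mulrCA mulVf ?mulr1 ?ler_nat // pnatr_eq0; lia.
  move=> /(ler_wpM2r (ltW (hQ_gt0 i))) /(le_trans le_i) le_i'.
  apply: le_trans (ler_wpM2l (ler0n _ k) le_i') _.
  by rewrite mulVKf // pnatr_eq0; lia.
rewrite -(card_in_imset cell_inj).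
apply: leq_trans (max_card _) _.
rewrite card_ffun !card_ord leq_pexp2l //.
Qed.

(** A side [h i = 0] makes coordinate [i] constant on [S], so it may be raised to 1. *)
Lemma card_separated (T : finType) d s k (h : 'I_d -> nat)
    (X : T -> 'rV[int]_d) (S : {set T}) (A : 'M[rat]_(s, d)) :
  (0 < k)%N -> bounded_on h X S -> separated_on h X S k ->
  (forall x y, x \in S -> y \in S -> (diffQ X x y <= A)%MS) ->
  (#|S| <= (2 * s * k).+1 ^ s)%N.
Proof.
move=> k_gt0 bS sS; apply: (@card_separated_pos _ _ _ _ (fun i => maxn (h i) 1) X) => //.
- by move=> i; lia.
- by move=> x y xS yS i; have := bS _ _ xS yS i; lia.
move=> x y xS yS le; apply: sS => // i.
have := bS _ _ xS yS i; have := le i.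
have [-> _|h_gt0] := posnP (h i); first by rewrite !leqn0 => /eqP ->; rewrite muln0.
by rewrite (maxn_idPl h_gt0).
Qed.

(** Vanishing 2x2 minors make every difference a multiple of one nonzero difference, so
    [card_separated] applies with a single row. *)
Lemma card_separated_rank1 (T : finType) d k (h : 'I_d -> nat)
    (X : T -> 'rV[int]_d) (S : {set T}) :
  (0 < k)%N -> bounded_on h X S -> separated_on h X S k ->
  (forall x y x' y', x \in S -> y \in S -> x' \in S -> y' \in S -> forall i l,
    (X x 0%R i - X y 0%R i) * (X x' 0%R l - X y' 0%R l) =
    (X x 0%R l - X y 0%R l) * (X x' 0%R i - X y' 0%R i)) ->
  (#|S| <= (2 * k).+1)%N.
Proof.
move=> k_gt0 bS sS min0.
have [S1|] := leqP #|S| 1; first by lia.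
move=> /card_gt1P[x [y [xS yS xy]]].
suff : (#|S| <= (2 * 1 * k).+1 ^ 1)%N by rewrite expn1 muln1.
apply: (card_separated (A := diffQ X x y) k_gt0 bS sS) => x' y' x'S y'S.
have [i di] : exists i, X x 0%R i - X y 0%R i != 0.
  apply/existsP; apply: contraNT xy => /existsPn e; apply/eqP/sS => // i.
  by have := e i; rewrite negbK => /eqP ->; rewrite muln0.
apply/sub_rVP; exists ((X x' 0%R i - X y' 0%R i)%:~R / (X x 0%R i - X y 0%R i)%:~R).
apply/rowP=> l; rewrite !mxE.
apply: (@mulfI _ (X x 0%R i - X y 0%R i)%:~R); first by rewrite intr_eq0.
rewrite mulrA mulrCA divff ?intr_eq0 // mulr1 -!intrM min0 //.
by rewrite mulrC.
Qed.

(** Take the largest [j] at which two distinct points are still close. It is bounded because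
    distinct integer points differ by at least 1 in some coordinate. *)
Lemma exists_level (T : finType) d (h : 'I_d -> nat) (X : T -> 'rV[int]_d)
    (S : {set T}) M :
  (forall i, h i <= M)%N -> bounded_on h X S -> {in S &, injective X} ->
  (1 < #|S|)%N ->
  exists j, [/\ (j <= trunc_log 2 M)%N,
    exists x y, [/\ x \in S, y \in S, x != y &
      forall i, (2 ^ j * `|X x 0%R i - X y 0%R i| <= h i)%N] &
    separated_on h X S (2 ^ j.+1)].
Proof.
move=> hM bS Xinj /card_gt1P[x0 [y0 [x0S y0S xy0]]].
pose P j := [exists x in S, exists y in S, (x != y) &&
  [forall i, (2 ^ j * `|X x 0%R i - X y 0%R i| <= h i)%N]].
have exP : exists j, P j.
  exists 0%N; apply/exists_inP; exists x0 => //; apply/exists_inP; exists y0 => //.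
  by rewrite xy0; apply/forallP=> i; rewrite mul1n bS.
have maxP j : P j -> (j <= trunc_log 2 M)%N.
  move=> /exists_inP[x xS /exists_inP[y yS /andP[xy /forallP le]]].
  apply: trunc_log_max => //.
  have [i di] : exists i, X x 0 i != X y 0 i.
    apply/existsP; apply: contraNT xy => /existsPn e; apply/eqP/Xinj => //.
    by apply/rowP=> i; have := e i; rewrite negbK => /eqP.
  apply: leq_trans (hM i); apply: leq_trans (le i).
  by rewrite leq_pmulr // absz_gt0 subr_eq0.
case: (ex_maxnP exP maxP) => j Pj jmax; exists j; split; first exact: maxP.
  move: Pj => /exists_inP[x xS /exists_inP[y yS /andP[xy /forallP le]]].
  by exists x, y.
move=> x y xS yS le; apply/eqP; apply: contraT => xy.
suff /jmax : P j.+1 by rewrite ltnn.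
apply/exists_inP; exists x => //; apply/exists_inP; exists y => //.
by rewrite xy; apply/forallP.
Qed.

(** * Integer points of boxes *)

Definition boxT d (h : 'I_d -> nat) := {dffun forall i : 'I_d, 'I_(h i)}.

Lemma card_boxT d (h : 'I_d -> nat) : #|{: boxT h}| = (\prod_i h i)%N.
Proof.
rewrite card_dep_ffun foldrE big_image /=.
by apply: eq_bigr => i _; rewrite card_ord.
Qed.

Definition boxpt d (N : 'I_d -> int) (h : 'I_d -> nat) (c : boxT h) : 'rV[int]_d :=
  \row_i (N i + 1 + (c i : nat)%:Z).

Lemma boxpt_bounds d (N : 'I_d -> int) (h : 'I_d -> nat) (c : boxT h) i :
  N i + 1 <= boxpt N c 0 i <= N i + (h i)%:Z.
Proof. by rewrite mxE; have := ltn_ord (c i); lia. Qed.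

Lemma boxpt_ex d (N : 'I_d -> int) (h : 'I_d -> nat) (x : 'rV[int]_d) :
  (forall i, N i + 1 <= x 0 i <= N i + (h i)%:Z) ->
  exists c : boxT h, boxpt N c = x.
Proof.
move=> bx.
have lt i : (`|x 0%R i - (N i + 1)%R| < h i)%N by have := bx i; lia.
exists [ffun i => Ordinal (lt i)]; apply/rowP=> i; rewrite mxE ffunE /=.
by have := bx i; lia.
Qed.

Lemma boxpt_inj d (N : 'I_d -> int) (h : 'I_d -> nat) :
  injective (@boxpt d N h).
Proof.
move=> c c' e; apply/ffunP=> i; apply/val_inj => /=.
by have /rowP/(_ i) := e; rewrite !mxE; lia.
Qed.

Lemma leq_card_box (T : finType) d (N : 'I_d -> int) (h : 'I_d -> nat)
    (e : 'rV[int]_d -> T) (S : {set T}) :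
  (forall t, t \in S ->
    exists x : 'rV[int]_d,
      (forall i, N i + 1 <= x 0 i <= N i + (h i)%:Z) /\ e x = t) ->
  (#|S| <= \prod_i h i)%N.
Proof.
move=> Sbox; rewrite -card_boxT.
apply: leq_trans (leq_imset_card (fun c => e (boxpt N c)) predT).
apply/subset_leq_card/subsetP=> t /Sbox[x [/boxpt_ex[c <-] <-]].
by apply/imsetP; exists c.
Qed.

Lemma leq_card_fibers (T : finType) d (N : 'I_d -> int) (h : 'I_d -> nat)
    (X : T -> 'rV[int]_d) (S : {set T}) (I : {pred 'I_d}) b :
  (forall x i, x \in S -> i \in I -> N i + 1 <= X x 0 i <= N i + (h i)%:Z) ->
  (forall x0, x0 \in S ->
    (#|[set x in S | [forall (i | i \in I), X x 0%R i == X x0 0%R i]]| <= b)%N) ->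
  (#|S| <= (\prod_(i in I) h i) * b)%N.
Proof.
move=> bX bf.
(* Coordinates outside [I] are set to 0, the only point of the range with offset -1 and side 1. *)
pose N' i := if i \in I then N i else -1.
pose h' i := if i \in I then h i else 1%N.
pose X' x : 'rV[int]_d := \row_i (if i \in I then X x 0 i else 0).
have -> : (\prod_(i in I) h i = #|{: boxT h'}|)%N by rewrite card_boxT big_mkcond.
have repr x : x \in S -> exists c : boxT h', boxpt N' c == X' x.
  move=> xS; have [|c <-] := @boxpt_ex _ N' h' (X' x); last by exists c.
  move=> i; rewrite /N' /h' mxE; case: ifPn => [/(bX _ _ xS)//|_]; lia.
rewrite -sum1_card.
apply: (@leq_trans (\sum_(x in S) \sum_(c : boxT h') (boxpt N' c == X' x))).
  apply: leq_sum => x /repr[c ec].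
  by rewrite (bigD1 c) //= ec.
rewrite exchange_big /= -sum_nat_const; apply: leq_sum => c _.
have -> : (\sum_(x in S) (boxpt N' c == X' x) = #|[set x in S | boxpt N' c == X' x]|)%N.
  rewrite -sum1_card [RHS](eq_bigl (fun x => (x \in S) && (boxpt N' c == X' x))).
    by rewrite big_mkcondr /=; apply: eq_bigr => x _; case: ifP.
  by move=> x; rewrite inE.
have [->|[x0]] := set_0Vmem [set x in S | boxpt N' c == X' x].
  by rewrite cards0.
rewrite inE => /andP[x0S /eqP cx0]; apply: leq_trans (bf x0 x0S).
apply/subset_leq_card/subsetP=> x; rewrite !inE => /andP[-> /eqP cx] /=.
apply/forall_inP=> i iI; have := cx; rewrite cx0 => /rowP/(_ i).
by rewrite !mxE iI => ->.
Qed.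

(** * Functionals that are small on a set *)

Section LargeSieve.
Variables (R : realType) (p : nat).
Hypothesis p_pr : prime p.

Let ang (k : int) : R := (pi *+ 2) * k%:~R / p%:R.

Let pi2_gt0 : 0 < pi *+ 2 :> R.
Proof. by rewrite pmulrn_lgt0 ?pi_gt0. Qed.

Let p_neq0 : p%:R != 0 :> R.
Proof. by rewrite pnatr_eq0 -lt0n prime_gt0. Qed.

Let periodic_int (f : R -> R) : periodic f (pi *+ 2) ->
  forall (m : int) a, f (a + (pi *+ 2) * m%:~R) = f a.
Proof.
move=> pf [] m a; first by rewrite -pmulrn mulr_natr periodicn.
rewrite NegzE mulrNz -pmulrn mulrN mulr_natr.
by rewrite -[in LHS](periodicn pf m.+1) subrK.
Qed.

Let angD k l : ang (k + l) = ang k + ang l.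
Proof. by rewrite /ang intrD mulrDr mulrDl. Qed.

Let angN k : ang (- k) = - ang k.
Proof. by rewrite /ang mulrNz mulrN mulNr. Qed.

Let eq_ang (f : R -> R) (k l : int) : periodic f (pi *+ 2) ->
  k%:~R = l%:~R :> 'F_p -> f (ang k) = f (ang l).
Proof.
move=> pf /eqP; rewrite -subr_eq0 -intrB.
rewrite -(dvdz_pcharf (pchar_Fp p_pr)) => /dvdzP[m em].
have -> : k = l + m * p%:Z by rewrite -em; ring.
rewrite angD -[RHS](periodic_int pf m); congr (f (_ + _)).
by rewrite /ang intrM -pmulrn mulrA mulfK.
Qed.

Let Fint (x : 'F_p) : int := (val x)%:Z.
Let FintK x : (Fint x)%:~R = x.
Proof. by rewrite /Fint -pmulrn natr_Zp. Qed.

(** [C] and [S] are the real and imaginary parts of the additive character e(x / p) of ['F_p]. *)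
Let C (x : 'F_p) := cos (ang (Fint x)).
Let S (x : 'F_p) := sin (ang (Fint x)).

Let CE k : C k%:~R = cos (ang k).
Proof. by apply: eq_ang; [exact: cosD2pi | rewrite FintK]. Qed.

Let SE k : S k%:~R = sin (ang k).
Proof. by apply: eq_ang; [exact: sinD2pi | rewrite FintK]. Qed.

Let CD x y : C (x + y) = C x * C y - S x * S y.
Proof. by rewrite -{1}[x]FintK -{1}[y]FintK -intrD CE angD cosD. Qed.

Let SD x y : S (x + y) = S x * C y + C x * S y.
Proof. by rewrite -{1}[x]FintK -{1}[y]FintK -intrD SE angD sinD. Qed.

Let CB x y : C (x - y) = C x * C y + S x * S y.
Proof. by rewrite -{1}[x]FintK -{1}[y]FintK -intrB CE angD angN cosB. Qed.

Let C1_lt1 : C 1 < 1.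
Proof.
have ang1 : ang 1 = pi *+ 2 / p%:R by rewrite /ang mulr1.
have ang1_gt0 : 0 < ang 1 by rewrite ang1 divr_gt0 ?pi2_gt0 ?ltr0n ?prime_gt0.
rewrite -[X in C X]/(1%:~R) CE -cos0 ltr_cos //.
  by rewrite in_itv /= lexx pi_ge0.
rewrite in_itv /= ltW //= ang1 ler_pdivrMr ?ltr0n ?prime_gt0 // -[pi *+ 2]mulr_natr.
by rewrite ler_wpM2l ?pi_ge0 // ler_nat prime_gt1.
Qed.

Variable n : nat.
Let dot (c v : 'rV['F_p]_n) := (c *m v^T) 0 0.

(** A shift by [c0], chosen with [dot c0 v = 1], multiplies the complex sum by e(1 / p), which is
    not 1. *)
Let sumC (v : 'rV['F_p]_n) : v != 0 -> \sum_c C (dot c v) = 0.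
Proof.
move=> /rV0Pn[i vi].
pose c0 : 'rV['F_p]_n := (v 0 i)^-1 *: delta_mx 0 i.
have dc0 c : dot (c + c0) v = dot c v + 1.
  rewrite /dot mulmxDl mxE; congr (_ + _).
  by rewrite -scalemxAl mxE -rowE !mxE mulVf.
have e1 : \sum_c C (dot c v) = (\sum_c C (dot c v)) * C 1 - (\sum_c S (dot c v)) * S 1.
  rewrite [LHS](reindex_inj (addIr c0)) /= !mulr_suml -sumrB.
  by apply: eq_bigr => c _; rewrite dc0 CD.
have e2 : \sum_c S (dot c v) = (\sum_c S (dot c v)) * C 1 + (\sum_c C (dot c v)) * S 1.
  rewrite [LHS](reindex_inj (addIr c0)) /= !mulr_suml -big_split /=.
  by apply: eq_bigr => c _; rewrite dc0 SD.
move: e1 e2; move: (\sum_c C (dot c v)) (\sum_c S (dot c v)) => s t e1 e2.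
have cs : S 1 ^+ 2 = 1 - C 1 ^+ 2 by rewrite sin2cos2.
(* The factor is [|1 - e(1 / p)|^2], the determinant of the system [e1], [e2] in [s] and [t]. *)
have : s * (2 * (1 - C 1)) = 0.
  transitivity (s * ((1 - C 1) ^+ 2 + S 1 ^+ 2)); last first.
    have -> : s * ((1 - C 1) ^+ 2 + S 1 ^+ 2) =
      (s - (s * C 1 - t * S 1)) * (1 - C 1) - (t - (t * C 1 + s * S 1)) * S 1.
      by ring.
    by rewrite -e1 -e2 !subrr !mul0r subrr.
  by rewrite cs; ring.
move=> /eqP; rewrite mulf_eq0 => /orP[/eqP//|].
by rewrite mulf_eq0 subr_eq0 [1 == _]eq_sym (lt_eqF C1_lt1) orbF pnatr_eq0.
Qed.

Let cos_small k : (8 * `|k| <= p)%N -> 2^-1 <= cos (ang k).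
Proof.
move=> k8.
have ang_norm : `|ang k| * 4 <= pi.
  rewrite /ang !normrM normfV (gtr0_norm pi2_gt0).
  rewrite -intr_norm [X in _ / X]ger0_norm ?ler0n // mulrAC.
  rewrite ler_pdivrMr ?ltr0n ?prime_gt0 // -mulrA mulrnAl -mulrnAr ler_wpM2l ?pi_ge0 //.
  by rewrite -natr_absz -natrM -mulrnA ler_nat; move: k8; rewrite mulnC; lia.
have pi0 := @pi_gt0 R.
have [a1 a2] : - pi <= ang k * 4 /\ ang k * 4 <= pi.
  by have := ler_norm (ang k); have := ler_norm (- ang k); rewrite normrN; split; lra.
have c0 : 0 <= cos (ang k) by apply: cos_ge0_pihalf; apply/andP; split; lra.
(* The doubled angle is at most pi / 2 in absolute value, so [c = cos (ang k)] satisfies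
   [2 c^2 >= 1]; with [0 <= c <= 1] this gives [c >= c^2 >= 1/2]. *)
have : 0 <= cos (ang k *+ 2).
  by rewrite mulr2n; apply: cos_ge0_pihalf; apply/andP; split; lra.
rewrite cos_mulr2n mulr2n => c2.
have c1 := cos_le1 (ang k); nra.
Qed.

(* Orthogonality of additive characters: on average over all functionals [c],
   [|sum_(v in V) e(c v / p)|^2] equals [#|V|], whereas a functional that is
   small on all of [V] contributes at least [(#|V| / 2)^2]. *)
Lemma card_small_functionals (W V : {set 'rV['F_p]_n}) :
  (forall c v, c \in W -> v \in V ->
     exists2 k : int, (8 * `|k| <= p)%N & (c *m v^T) 0 0 = k%:~R) ->
  (#|W| * #|V| <= 4 * p ^ n)%N.
Proof.
move=> small.
have [->|[v0 v0V]] := set_0Vmem V; first by rewrite cards0 muln0.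
have V_gt0 : (0 < #|V|)%N by apply/card_gt0P; exists v0.
pose g c := (\sum_(v in V) C (dot c v)) ^+ 2 + (\sum_(v in V) S (dot c v)) ^+ 2.
have gE c : g c = \sum_(v in V) \sum_(u in V) C (dot c (v - u)).
  rewrite /g !expr2 !mulr_suml -big_split /=; apply: eq_bigr => v _.
  rewrite !mulr_sumr -big_split /=; apply: eq_bigr => u _.
  by rewrite /dot raddfB mulmxBr !mxE CB.
have sum_g : \sum_c g c = (p ^ n * #|V|)%:R.
  under eq_bigr do rewrite gE.
  rewrite exchange_big /=.
  transitivity (\sum_(v in V) (p ^ n)%:R : R); last first.
    by rewrite sumr_const natrM mulr_natr.
  apply: eq_bigr => v vV; rewrite exchange_big /= (bigD1 v) //=.
  rewrite [X in _ + X]big1 => [|u /andP[_ uv]]; last first.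
    by apply: sumC; rewrite subr_eq0 eq_sym.
  rewrite addr0 (eq_bigr (fun=> 1)) => [|c _].
    by rewrite sumr_const card_mx card_Fp // mul1n.
  by rewrite subrr /dot trmx0 mulmx0 mxE -[0]/(0%:~R) CE /ang mulr0 mul0r cos0.
have g_ge0 c : 0 <= g c by rewrite addr_ge0 ?sqr_ge0.
have gW c : c \in W -> (#|V|%:R / 2) ^+ 2 <= g c.
  move=> cW; rewrite /g -[leLHS]addr0 lerD ?sqr_ge0 //.
  have -> : #|V|%:R / 2 = \sum_(v in V) 2^-1 :> R by rewrite sumr_const mulr_natl.
  have le : \sum_(v in V) 2^-1 <= \sum_(v in V) C (dot c v).
    apply: ler_sum => v vV; have [k k8 e] := small c v cW vV.
    by rewrite /dot e CE cos_small.
  have ge0 : 0 <= \sum_(v in V) 2^-1 :> R by apply: sumr_ge0 => v _; rewrite invr_ge0.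
  by rewrite ler_sqr ?nnegrE // (le_trans ge0).
have : #|W|%:R * (#|V|%:R / 2) ^+ 2 <= (p ^ n * #|V|)%:R :> R.
  rewrite -sum_g mulr_natl -sumr_const (bigID (mem W) predT) /=.
  by rewrite -[leLHS]addr0 lerD ?sumr_ge0 // ler_sum.
rewrite expr_div_n mulrA ler_pdivrMr ?exprn_gt0 // -!natrX -!natrM ler_nat.
move=> le; rewrite -(leq_pmul2r V_gt0) -mulnA mulnn (leq_trans le) //.
by rewrite mulnC mulnA.
Qed.
End LargeSieve.

(** * Coordinates in a basis over the prime field *)

Definition ev (F : finFieldType) n (w : n.-tuple F) (x : 'rV[int]_n) : F :=
  \sum_(i < n) tnth w i *~ x 0 i.

Definition redp p n (x : 'rV[int]_n) : 'rV['F_p]_n := map_mx intr x.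

(** Apart from [basis3_quadratic], the basis enters only through these properties of its coordinate
    map. *)
Record coordinates (F : finFieldType) p n (w : n.-tuple F)
    (r : F -> 'rV['F_p]_n) : Prop := Coordinates {
  coord_ev : forall x, r (ev w x) = redp p x;
  coordD : {morph r : x y / x + y};
  coord_inj : injective r }.

Lemma basis_coordinates (F : finFieldType) p n (hp : prime p)
    (hF : #|F| = (p ^ n)%N) (w : n.-tuple F) :
  Fp_basis hp hF w -> exists r, coordinates (p := p) w r.
Proof.
rewrite /Fp_basis; set L := pPrimeCharType _ => wB.
exists (fun z : F => \row_i coord (w : n.-tuple L) i (z : L)); split.
- move=> x; apply/rowP=> k; rewrite !mxE.
  have -> : (ev w x : L) = \sum_(i < n) (w : n.-tuple L)`_i *~ x 0 i.
    by apply: eq_bigr => i _; rewrite (tnth_nth 0).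
  rewrite linear_sum /= (bigD1 k) //= big1 ?addr0 => [|i ik]; rewrite raddfMz /=.
    by rewrite coord_free ?(basis_free wB) // eqxx.
  by rewrite coord_free ?(basis_free wB) // (negbTE ik) mul0rz.
- by move=> x y; apply/rowP=> k; rewrite !mxE -linearD.
move=> x y /rowP e.
rewrite -[x]/(x : L) (coord_basis wB (memvf (x : L))).
rewrite -[y]/(y : L) (coord_basis wB (memvf (y : L))).
by apply: eq_bigr => i _; have := e i; rewrite !mxE => ->.
Qed.
Lemma dehomogenize_quadratic (K : fieldType) (x y : K) (a b c : int) : x != 0 ->
  x ^+ 2 * (a%:~R + b%:~R * (y / x) + c%:~R * (y / x) ^+ 2) =
  x ^+ 2 *~ a + (x * y) *~ b + y ^+ 2 *~ c.
Proof.
move=> x0; rewrite -[x ^+ 2 *~ a]mulrzr -[_ *~ b]mulrzr -[_ *~ c]mulrzr.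
by field.
Qed.

(** A nontrivial relation would give [t = w_j / w_i] degree at most 2 over the prime field. The
    degree divides 3, so it is 1 and [t] is a scalar, against the independence of [w_i] and
    [w_j]. *)
Lemma basis3_quadratic (F : finFieldType) p (hp : prime p) (hF : #|F| = (p ^ 3)%N)
    (w : 3.-tuple F) (i j : 'I_3) (a b c : int) :
  Fp_basis hp hF w -> i != j ->
  tnth w i ^+ 2 *~ a + (tnth w i * tnth w j) *~ b + tnth w j ^+ 2 *~ c = 0 ->
  [/\ a%:~R = 0 :> 'F_p, b%:~R = 0 :> 'F_p & c%:~R = 0 :> 'F_p].
Proof.
rewrite /Fp_basis; set L := pPrimeCharType _ => wB ij e.
have pF : p \in [pchar F] := card_finPcharP hF hp.
have wfree := basis_free wB.
have wi0 (k : 'I_3) : (tnth w k : L) != 0.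
  apply/eqP => w0; have := coord_free k k wfree.
  by rewrite -tnth_nth w0 linear0 eqxx => /eqP; rewrite eq_sym oner_eq0.
have [t tE] : exists t : L, t = (tnth w j : L) / (tnth w i : L) by exists (tnth w j / tnth w i : L).
pose q : {poly L} := (a%:~R)%:P + (b%:~R)%:P * 'X + (c%:~R)%:P * 'X^2.
have q0 : q = 0.
  apply/eqP; apply: contraT => q0.
  have qK : q \is a polyOver (1%VS : {vspace L}).
    by rewrite !rpredD ?rpredM ?polyOverC ?polyOverX ?rpredX ?polyOverX //; apply: rpred_int.
  have tq : root q t.
    rewrite /root !hornerE; apply/eqP.
    apply: (mulfI (expf_neq0 2 (wi0 i))); rewrite mulr0 -[RHS]e.
    have := dehomogenize_quadratic (tnth w j : L) a b c (wi0 i); rewrite -tE => <-.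
    by rewrite expr2 !mulrA.
  have dvd := minPoly_dvdp qK tq.
  have sq : (size q <= 3)%N.
    rewrite /q; apply: leq_trans (size_polyD _ _) _; rewrite geq_max; apply/andP; split.
      apply: leq_trans (size_polyD _ _) _; rewrite geq_max (leq_trans (size_polyC_leq1 _)) //=.
      by rewrite mul_polyC (leq_trans (size_scale_leq _ _)) // size_polyX.
    by rewrite mul_polyC (leq_trans (size_scale_leq _ _)) // size_polyXn.
  have deg2 : (adjoin_degree 1 t <= 2)%N.
    by rewrite -ltnS -size_minPoly (leq_trans (dvdp_leq q0 dvd)).
  have deg3 : (adjoin_degree 1 t %| 3)%N.
    have := field_dimS (subvf <<1; t>>%AS).
    rewrite /= dim_Fadjoin dimv1 muln1.
    have dimL : \dim {:L} = 3%N by exact: (size_basis wB).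
    by move=> dvd3; apply: dvdn_trans dvd3 _; rewrite [X in (X %| _)%N]dimL.
  have deg1 : adjoin_degree 1 t = 1%N.
    by move: deg2 deg3; case: (adjoin_degree 1 t) => [|[|[|]]].
  have : t \in 1%VS by rewrite -adjoin_deg_eq1 deg1.
  move=> /vlineP[k tk].
  have wji : (tnth w j : L) = k *: (tnth w i : L).
    by rewrite -[LHS](divfK (wi0 i)) -tE tk -scalerAl mul1r.
  have := coord_free j j wfree; rewrite -tnth_nth wji linearZ /= (tnth_nth 0).
  have ji : (j == i) = false by rewrite eq_sym (negbTE ij).
  rewrite coord_free // eqxx ?ji ?(negbTE ij) /= ?mulr0n ?scaler0 ?mulr0 => /eqP.
  by rewrite eq_sym oner_eq0.
have intr0 (m : int) : m%:~R = 0 :> F -> m%:~R = 0 :> 'F_p.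
  by move=> /eqP; rewrite -(dvdz_pcharf pF) (dvdz_pcharf (pchar_Fp hp)) => /eqP.
have qE k : q`_k = (if k == 0 then a else if k == 1 then b else if k == 2 then c else 0)%N%:~R.
  rewrite !coefD !coefCM coefC coefX coefXn.
  by case: k => [|[|[|k]]] /=; rewrite ?mulr0 ?mulr1 ?addr0 ?add0r.
by split; apply: intr0; [have := qE 0%N | have := qE 1%N | have := qE 2%N];
  rewrite q0 coef0 /= => <-.
Qed.

Section Coordinates.
Variables (F : finFieldType) (p n : nat) (w : n.-tuple F) (r : F -> 'rV['F_p]_n).
Hypotheses (p_pr : prime p) (rP : coordinates w r).

Lemma evD : {morph ev w : x y / x + y}.
Proof.
move=> x y; rewrite /ev -big_split /=; apply: eq_bigr => i _.
by rewrite mxE mulrzDr.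
Qed.

Lemma evN : {morph ev w : x / - x}.
Proof.
move=> x; rewrite /ev -sumrN; apply: eq_bigr => i _.
by rewrite mxE mulrNz.
Qed.

Lemma evB : {morph ev w : x y / x - y}.
Proof. by move=> x y; rewrite evD evN. Qed.

Lemma redpB (m : nat) : {morph @redp p m : x y / x - y}.
Proof. by move=> x y; rewrite /redp map_mxB. Qed.

Lemma redp_surj m (a : 'rV['F_p]_m) : exists x, redp p x = a.
Proof.
exists (\row_i (val (a 0 i))%:Z); apply/rowP=> i; rewrite !mxE.
by rewrite -pmulrn natr_Zp.
Qed.

Lemma ev_surj z : exists x, ev w x = z.
Proof.
have [x xE] := redp_surj (r z); exists x.
by apply: (coord_inj rP); rewrite (coord_ev rP).
Qed.

Lemma ev_eqE x y : (ev w x = ev w y) <-> (redp p x = redp p y).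
Proof.
split=> [e|e]; first by rewrite -!(coord_ev rP) e.
by apply: (coord_inj rP); rewrite !(coord_ev rP).
Qed.

Lemma intr_Fp_eq0 (k : int) : k%:~R = 0 :> 'F_p -> (`|k| < p)%N -> k = 0.
Proof.
move=> /eqP; rewrite -(dvdz_pcharf (pchar_Fp p_pr)) => /dvdzP[m ->] lt.
suff -> : m = 0 by rewrite mul0r.
apply/eqP; rewrite -absz_eq0 -leqn0 -ltnS -(ltn_pmul2r (prime_gt0 p_pr)).
by rewrite mul1n; move: lt; rewrite abszM.
Qed.

Lemma intr_Fp_inj (k l : int) :
  k%:~R = l%:~R :> 'F_p -> (`|k - l| < p)%N -> k = l.
Proof.
move=> e lt; apply/eqP; rewrite -subr_eq0; apply/eqP/intr_Fp_eq0 => //.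
by rewrite intrB e subrr.
Qed.

Lemma redp_inj m (x y : 'rV[int]_m) :
  redp p x = redp p y -> (forall i, `|x 0%R i - y 0%R i| < p)%N -> x = y.
Proof.
move=> /rowP e lt; apply/rowP=> i; apply: intr_Fp_inj => //.
by have := e i; rewrite !mxE.
Qed.

(** Row [k] of [M z] holds the coordinates of [z * w_k]. As [r] is only known to be additive, its
    compatibility with scalars is derived for integers. *)
Lemma coord_mulmx : exists M : F -> 'M['F_p]_n, forall z y, r (z * y) = r y *m M z.
Proof.
exists (fun z => \matrix_k r (z * tnth w k)) => z y.
have r0 : r 0 = 0 by apply: (addrI (r 0)); rewrite -(coordD rP) !addr0.
have rN x : r (- x) = - r x.
  by apply: (addrI (r x)); rewrite -(coordD rP) !subrr.
have rn x m : r (x *+ m) = r x *+ m.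
  by elim: m => [|m IH]; rewrite ?mulr0n // !mulrS (coordD rP) IH.
have rz x (m : int) : r (x *~ m) = m%:~R *: r x.
  case: m => m; first by rewrite -!pmulrn rn scaler_nat.
  by rewrite NegzE !mulrNz -!pmulrn rN rn scaleNr scaler_nat.
have [x <-] := ev_surj y.
rewrite (coord_ev rP) mulmx_sum_row /ev mulr_sumr.
rewrite (big_morph r (coordD rP) r0); apply: eq_bigr => i _.
by rewrite mulrzAr rz rowK mxE.
Qed.

Variables (N : 'I_n -> int) (h : 'I_n -> nat).
Let B := box w N (fun i => (h i)%:Z).

Lemma in_box z : reflect
  (exists2 x : 'rV[int]_n, (forall i, N i + 1 <= x 0 i <= N i + (h i)%:Z) & ev w x = z)
  (z \in B).
Proof.
rewrite inE; apply: (iffP (asboolP _)) => [[x [bx ->]]|[x bx <-]].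
  exists (\row_i x i) => [i|]; first by rewrite mxE.
  by apply: eq_bigr => i _; rewrite mxE.
by exists (x 0).
Qed.

Lemma card_box : (forall i, h i <= p)%N -> #|B| = (\prod_i h i)%N.
Proof.
move=> hp; apply/eqP; rewrite eqn_leq; apply/andP; split.
  apply: (@leq_card_box _ _ N h (ev w)) => z /in_box[x bx ex].
  by exists x.
rewrite -card_boxT.
have inj : injective (fun c => ev w (@boxpt _ N h c)).
  move=> c c' /ev_eqE /redp_inj e; apply: (@boxpt_inj _ N); apply: e => i.
  have := boxpt_bounds N c i; have := boxpt_bounds N c' i; have := hp i; lia.
rewrite -(card_imset _ inj); apply/subset_leq_card/subsetP => _ /imsetP[c _ ->].
by apply/in_box; exists (boxpt N c) => // i; apply: boxpt_bounds.
Qed.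

Lemma box_coords : exists X : F -> 'rV[int]_n,
  (forall z, ev w (X z) = z) /\
  (forall z, z \in B -> forall i, N i + 1 <= X z 0 i <= N i + (h i)%:Z).
Proof.
have /choice[X XP] : forall z, exists x, ev w x = z /\
    (z \in B -> forall i, N i + 1 <= x 0 i <= N i + (h i)%:Z).
  move=> z; case: (boolP (z \in B)) => [/in_box[x bx ex]|_]; first by exists x.
  by have [x ex] := ev_surj z; exists x.
by exists X; split=> z; have [] := XP z.
Qed.

End Coordinates.

(** * The energy as a sum over ratios *)

Lemma leq_card_bigcup (I T : finType) (A : I -> {set T}) :
  (#|\bigcup_i A i| <= \sum_i #|A i|)%N.
Proof.
apply: (big_ind2 (fun (U : {set T}) m => #|U| <= m)%N) => [|U m V k Um Vk|//].
  by rewrite cards0.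
by apply: leq_trans (leq_add Um Vk); exact: leq_of_leqif (leq_card_setU U V).
Qed.

(** The set S_z of the overview. *)
Definition slice (F : finFieldType) (B : {set F}) (z : F) : {set F} :=
  [set y in B | (y != 0) && (z * y \in B)].

Lemma in_slice (F : finFieldType) (B : {set F}) z y :
  (y \in slice B z) = [&& y \in B, y != 0 & z * y \in B].
Proof. by rewrite inE. Qed.

(** Count pairs [(z, y)] by [y]: for nonzero [y] the map [z -> z * y] is injective, so at most [|B|]
    values of [z] send [y] into [B]. *)
Lemma sum_card_slice (F : finFieldType) (B : {set F}) :
  (\sum_z #|slice B z| <= #|B| ^ 2)%N.
Proof.
have -> : (\sum_z #|slice B z| =
  \sum_(y in B | y != 0%R) #|[set z | (z * y)%R \in B]|)%N.
  transitivity (\sum_z \sum_(y | (y \in B) && (y != 0%R) && ((z * y)%R \in B)) 1)%N.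
    by apply: eq_bigr => z _; rewrite -sum1_card; apply: eq_bigl => y; rewrite inE andbA.
  rewrite (exchange_big_dep (fun y => (y \in B) && (y != 0))) /= => [|z y _]; last by case/andP.
  apply: eq_bigr => y /andP[yB y0]; rewrite -sum1_card; apply: eq_bigl => z.
  by rewrite yB y0 inE.
apply: (@leq_trans (\sum_(y in B | y != 0%R) #|B|)).
  apply: leq_sum => y /andP[_ y0].
  rewrite -(card_imset _ (mulIf y0)); apply/subset_leq_card/subsetP=> _ /imsetP[z + ->].
  by rewrite inE.
rewrite sum_nat_const expnS expn1 leq_mul2r.
by apply/orP; right; apply/subset_leq_card/subsetP=> y /andP[].
Qed.

(** Solutions with [v = 0] or [y = 0] lie in [A1], [A2] or [A3], each parametrized by two elements
    of [B]. Any other is determined by [z = x / v = t / y] and the elements [v], [y] of the slice of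
    [z]. *)
Lemma mul_energy_le (F : finFieldType) (B : {set F}) :
  (mul_energy B <= 3 * #|B| ^ 2 + \sum_z #|slice B z| ^ 2)%N.
Proof.
pose BB := setX B B.
pose A1 := [set (0 : F, u.1, 0 : F, u.2) | u in BB].
pose A2 := [set (u.1, 0 : F, 0 : F, u.2) | u in BB].
pose A3 := [set (u.1, 0 : F, u.2, 0 : F) | u in BB].
pose A4 z := [set (z * u.1, u.2, u.1, z * u.2) | u in setX (slice B z) (slice B z)].
have sub : [set q : F * F * F * F | let: (x, y, w, t) := q in
      [&& x \in B, y \in B, w \in B, t \in B & x * y == w * t]]
    \subset A1 :|: A2 :|: A3 :|: \bigcup_z A4 z.
  apply/subsetP=> -[[[x y] v] t]; rewrite inE => /and5P[xB yB vB tB /eqP e].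
  rewrite !inE; have [v0|v0] := eqVneq v 0.
    move: e; rewrite v0 mul0r => /eqP; rewrite mulf_eq0 => /orP[]/eqP xy0.
      apply/orP; left; apply/orP; left; apply/orP; left.
      by apply/imsetP; exists (y, t); rewrite ?inE ?yB //= xy0.
    apply/orP; left; apply/orP; left; apply/orP; right.
    by apply/imsetP; exists (x, t); rewrite ?inE ?xB //= xy0.
  have [y0|y0] := eqVneq y 0.
    move: e; rewrite y0 mulr0 => /esym/eqP; rewrite mulf_eq0 (negbTE v0) => /eqP t0.
    apply/orP; left; apply/orP; right.
    by apply/imsetP; exists (x, v); rewrite ?inE ?xB //= t0.
  apply/orP; right; apply/bigcupP; exists (x / v) => //.
  have ev : x / v * v = x by rewrite divfK.
  have ey : x / v * y = t by rewrite mulrAC e mulrAC divff // mul1r.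
  by apply/imsetP; exists (v, y); rewrite ?inE /= ?ev ?ey ?vB ?v0 ?xB ?yB ?y0 ?tB.
have cBB (A : {set F * F * F * F}) (f : F * F -> F * F * F * F) :
    A = f @: BB -> (#|A| <= #|B| ^ 2)%N.
  by move=> ->; apply: leq_trans (leq_imset_card _ _) _; rewrite cardsX mulnn.
have c1 : (#|A1| <= #|B| ^ 2)%N by apply: cBB.
have c2 : (#|A2| <= #|B| ^ 2)%N by apply: cBB.
have c3 : (#|A3| <= #|B| ^ 2)%N by apply: cBB.
have c4 : (#|\bigcup_z A4 z| <= \sum_z #|slice B z| ^ 2)%N.
  apply: leq_trans (leq_card_bigcup _) _; apply: leq_sum => z _.
  by apply: leq_trans (leq_imset_card _ _) _; rewrite cardsX mulnn.
apply: leq_trans (subset_leq_card sub) _.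
have cU (U V : {set F * F * F * F}) : (#|U :|: V| <= #|U| + #|V|)%N.
  by exact: leq_of_leqif (leq_card_setU U V).
apply: leq_trans (cU _ _) _; apply: leq_add => //.
apply: leq_trans (cU _ _) _.
rewrite !mulSn mul0n addn0 addnA; apply: leq_add c3.
exact: leq_trans (cU _ _) (leq_add c1 c2).
Qed.

(** Where [f z <= c], the square is at most [c * f z]. Every other [z] lies in one of at most [K]
    classes of some level, and each class contributes at most [D]. *)
Lemma sum_sqr_levels (F : finFieldType) (f : F -> nat) (c D J K : nat)
    (G : nat -> seq {set F}) :
  (forall z, (f z <= c)%N \/
    exists j, (j <= J)%N /\ exists2 A, A \in G j & z \in A) ->
  (forall j A, A \in G j -> (\sum_(z in A) f z ^ 2 <= D)%N) ->
  (forall j, size (G j) <= K)%N ->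
  (\sum_z f z ^ 2 <= c * (\sum_z f z) + J.+1 * (K * D))%N.
Proof.
move=> cover bound sizeG.
apply: (@leq_trans (c * (\sum_z f z) +
    \sum_(j < J.+1) \sum_(A <- G j) \sum_(z in A) f z ^ 2)).
  have -> : (\sum_(j < J.+1) \sum_(A <- G j) \sum_(z in A) f z ^ 2 =
     \sum_z \sum_(j < J.+1) \sum_(A <- G j) (z \in A) * f z ^ 2)%N.
    rewrite [RHS]exchange_big /=; apply: eq_bigr => j _.
    rewrite [RHS]exchange_big /=; apply: eq_bigr => A _.
    by rewrite big_mkcond /=; apply: eq_bigr => z _; case: ifP; rewrite ?mul1n.
  rewrite big_distrr -big_split /=; apply: leq_sum => z _.
  have [fc|[j [jJ [A AG zA]]]] := cover z.
    by apply: leq_trans (leq_addr _ _); rewrite -mulnn leq_mul2r fc orbT.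
  apply: leq_trans (leq_addl _ _).
  rewrite (bigD1 (Ordinal (jJ : (j < J.+1)%N))) //= (big_rem A) //= zA mul1n.
  by rewrite -addnA leq_addr.
rewrite leq_add2l -[X in (X * _)%N]card_ord -sum_nat_const.
apply: leq_sum => j _.
apply: (@leq_trans (\sum_(A <- G j) D)); last first.
  by rewrite big_const_seq iter_addn_0 count_predT mulnC leq_mul2r sizeG orbT.
by rewrite big_seq [leqRHS]big_seq; apply: leq_sum => A /bound.
Qed.

(** The balance used at every level: at most [m^2] terms, each at most [(D / m)^2]. If [m = 0], the
    class is empty. *)
Lemma sum_sqr_class (F : finFieldType) (f : F -> nat) (A : {set F}) m D :
  (#|A| <= m ^ 2)%N -> (forall z, z \in A -> m * f z <= D)%N ->
  (\sum_(z in A) f z ^ 2 <= D ^ 2)%N.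
Proof.
move=> Am fD; have [m0|m_gt0] := posnP m.
  by move: Am; rewrite m0 leqn0 cards_eq0 => /eqP ->; rewrite big_set0.
have m2_gt0 : (0 < m ^ 2)%N by rewrite expn_gt0 m_gt0.
rewrite -(leq_pmul2l m2_gt0) big_distrr /=.
apply: (@leq_trans (\sum_(z in A) D ^ 2)).
  by apply: leq_sum => z /fD fz; rewrite -expnMn leq_exp2r.
by rewrite sum_nat_const leq_mul2r Am orbT.
Qed.

(** * Primal and dual lattices *)

Definition dbl n (g : 'I_n -> nat) (i : 'I_(n + n)) : nat :=
  match split i with inl k => g k | inr k => g k end.

Lemma dbl_lshift n (g : 'I_n -> nat) k : dbl g (lshift n k) = g k.
Proof. by rewrite /dbl -[lshift n k]/(unsplit (inl k)) unsplitK. Qed.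

Lemma dbl_rshift n (g : 'I_n -> nat) k : dbl g (rshift n k) = g k.
Proof. by rewrite /dbl -[rshift n k]/(unsplit (inr k)) unsplitK. Qed.

Lemma forall_dbl n (P : 'I_(n + n) -> Prop) :
  (forall k, P (lshift n k)) -> (forall k, P (rshift n k)) -> forall i, P i.
Proof. by move=> Pl Pr i; rewrite -(splitK i); case: (split i). Qed.

Lemma sum_dbl n (u : 'I_(n + n) -> nat) :
  (\sum_i u i = \sum_k u (lshift n k) + \sum_k u (rshift n k))%N.
Proof. by rewrite big_split_ord. Qed.

Definition small_set (T : finType) n (e : 'rV[int]_n -> T) (g : 'I_n -> nat) j :
    {set T} :=
  [set t | `[< exists x : 'rV[int]_n,
     (forall i, (2 ^ j * `|x 0%R i| <= g i)%N) /\ e x = t >]].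

Lemma mem_small_set (T : finType) n (e : 'rV[int]_n -> T) (g : 'I_n -> nat) j
    (x : 'rV[int]_n) :
  (forall i, (2 ^ j * `|x 0%R i| <= g i)%N) -> e x \in small_set e g j.
Proof. by move=> gx; rewrite inE; apply/asboolP; exists x. Qed.

Lemma card_small_set (T : finType) n (e : 'rV[int]_n -> T) (g : 'I_n -> nat) j :
  (#|small_set e g j| <= \prod_i (2 * (g i %/ 2 ^ j)).+1)%N.
Proof.
apply: (@leq_card_box _ _ (fun i => - (g i %/ 2 ^ j)%N%:Z - 1)%R _ e) => t.
rewrite inE => /asboolP[x [gx ex]]; exists x; split=> // i.
have : (`|x 0%R i| <= g i %/ 2 ^ j)%N by rewrite leq_divRL ?expn_gt0 // mulnC.
by move: (_ %/ _)%N => m; lia.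
Qed.

Definition intdot d (u v : 'rV[int]_d) : int := (u *m v^T) 0 0.

Lemma intdotE d (u v : 'rV[int]_d) : intdot u v = \sum_i u 0 i * v 0 i.
Proof. by rewrite /intdot mxE; apply: eq_bigr => i _; rewrite mxE. Qed.

Lemma intdotBr d (u v v' : 'rV[int]_d) :
  intdot u (v - v') = intdot u v - intdot u v'.
Proof. by rewrite /intdot raddfB /= mulmxBr !mxE. Qed.

Lemma intdot_le d (u v : 'rV[int]_d) (g : 'I_d -> nat) :
  (forall i, `|u 0%R i| * `|v 0%R i| <= g i)%N ->
  (`|intdot u v| <= \sum_i g i)%N.
Proof.
move=> le; rewrite intdotE.
have : forall (I : seq 'I_d), (`|(\sum_(i <- I) u 0 i * v 0 i)%R| <= \sum_(i <- I) g i)%N.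
  elim=> [|i I IH]; first by rewrite !big_nil.
  rewrite !big_cons; have := le i; rewrite -abszM.
  move: (u 0 i * v 0 i) (\sum_(_ <- _) _) (\sum_(_ <- _) _)%N IH => a b c; lia.
by apply.
Qed.

Lemma large_fibre (T U : finType) (f : T -> U) : (0 < #|T|)%N ->
  exists c, (#|T| <= #|f @: T| * #|[set t | f t == c]|)%N.
Proof.
move=> /card_gt0P[t0 _].
have [t _ tmax] := @arg_maxnP _ t0 xpredT (fun t => #|[set u | f u == f t]|) isT.
exists (f t); rewrite -[leqLHS]sum1_card.
rewrite (partition_big f (fun c => c \in f @: T)) /= => [|u _]; last exact: imset_f.
rewrite -sum_nat_const; apply: leq_sum => _ /imsetP[u _ ->].
rewrite sum1_card; apply: leq_trans (tmax u isT).
by apply/subset_leq_card/subsetP=> v; rewrite inE.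
Qed.

Lemma leq_expl m1 m2 e : (m1 <= m2)%N -> (m1 ^ e <= m2 ^ e)%N.
Proof. by move=> le; case: e => // e; rewrite leq_exp2r. Qed.

(** * The dichotomy for a single ratio *)

Section Dichotomy.
Variables (R : realType) (F : finFieldType) (p n : nat) (w : n.-tuple F)
  (r : F -> 'rV['F_p]_n).
Hypotheses (p_pr : prime p) (rP : coordinates w r).
Variables (N : 'I_n -> int) (h : 'I_n -> nat).
Let B := box w N (fun i => (h i)%:Z).
Hypotheses (n_gt0 : (0 < n)%N) (h_gt0 : forall i, (0 < h i)%N)
  (h_sqr : forall i, (2 * h i ^ 2 < p)%N).
Variable X : F -> 'rV[int]_n.
Hypotheses (XE : forall z, ev w (X z) = z)
  (XB : forall z, z \in B -> forall i, N i + 1 <= X z 0 i <= N i + (h i)%:Z).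

(** For fixed [z] these points lie in the lattice of all [(a, b)] with [a = b M_z] modulo [p], where
    [M_z] is the matrix of multiplication by [z]. *)
Definition pairX z y : 'rV[int]_(n + n) := row_mx (X (z * y)) (X y).

Lemma pairX_l z y k : pairX z y 0 (lshift n k) = X (z * y) 0 k.
Proof. exact: row_mxEl. Qed.

Lemma pairX_r z y k : pairX z y 0 (rshift n k) = X y 0 k.
Proof. exact: row_mxEr. Qed.

Lemma pairX_inj z : injective (pairX z).
Proof. by move=> x y /eq_row_mx[_ e]; rewrite -[x]XE e XE. Qed.

Lemma slice_dist z y y' (k : 'I_n) : y \in slice B z -> y' \in slice B z ->
  (`|X (z * y)%R 0%R k - X (z * y')%R 0%R k| <= h k)%N /\
  (`|X y 0%R k - X y' 0%R k| <= h k)%N.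
Proof.
clear p_pr n_gt0 h_gt0 h_sqr.
rewrite !in_slice => /and3P[yB _ zyB] /and3P[y'B _ zy'B].
have := XB yB k; have := XB zyB k; have := XB y'B k; have := XB zy'B k.
by move=> /= *; split; lia.
Qed.

Lemma pairX_bounded z : bounded_on (dbl h) (pairX z) (slice B z).
Proof.
move=> y y' yS y'S; apply: forall_dbl => k;
  have [l1 l2] := slice_dist k yS y'S.
  by rewrite dbl_lshift !pairX_l.
by rewrite dbl_rshift !pairX_r.
Qed.

Lemma h_lt i : (h i < p)%N.
Proof.
clear p_pr n_gt0; apply: leq_trans (h_sqr i).
by have := h_gt0 i; rewrite expnS expn1; nia.
Qed.

Definition ratio_set j : {set F} :=
  [set z | [exists a in small_set (ev w) h j, exists b in small_set (ev w) h j,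
     (b != 0) && (z * b == a)]].

Lemma card_ratio_set j :
  (#|ratio_set j| <= (\prod_i (2 * (h i %/ 2 ^ j)).+1) ^ 2)%N.
Proof.
pose D := small_set (ev w) h j.
apply: (@leq_trans (#|D| ^ 2)); last by rewrite leq_exp2r // card_small_set.
rewrite -mulnn -cardsX; apply: leq_trans (leq_imset_card (fun u => u.1 / u.2) _).
apply/subset_leq_card/subsetP=> z; rewrite inE.
move=> /exists_inP[a aD /exists_inP[b bD /andP[b0 /eqP zb]]].
by apply/imsetP; exists (a, b); rewrite ?in_setX /= ?aD ?bD // -zb mulfK.
Qed.

Lemma slice_level z : (1 < #|slice B z|)%N ->
  exists j, [/\ (j <= trunc_log 2 p)%N, z \in ratio_set j &
    separated_on (dbl h) (pairX z) (slice B z) (2 ^ j.+1)].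
Proof.
move=> S1; have hp : forall i, (dbl h i <= p)%N.
  by apply: forall_dbl => k; rewrite ?dbl_lshift ?dbl_rshift ltnW // h_lt.
have [j [jJ [y [y' [yS y'S yy' le]]] sep]] :=
  exists_level hp (@pairX_bounded z) (in2W (@pairX_inj z)) S1.
exists j; split=> //; rewrite inE; apply/exists_inP; exists (z * y - z * y').
  rewrite -[z * y]XE -[z * y']XE -evB; apply: mem_small_set => k.
  by have := le (lshift n k); rewrite dbl_lshift !pairX_l !mxE.
apply/exists_inP; exists (y - y').
  rewrite -[y]XE -[y']XE -evB; apply: mem_small_set => k.
  by have := le (rshift n k); rewrite dbl_rshift !pairX_r !mxE.
by rewrite subr_eq0 yy' mulrBr eqxx.
Qed.

Variable M : F -> 'M['F_p]_n.
Hypothesis ME : forall z y, r (z * y) = r y *m M z.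

Lemma r_redp y : r y = redp p (X y).
Proof. by rewrite -(coord_ev rP) XE. Qed.

(** The vector of the functional [r y -> a . r (z * y) + b . r y]; the dual lattice consists of the
    [(a, b)] for which it vanishes. *)
Definition kappa z (a b : 'rV[int]_n) : 'rV['F_p]_n :=
  redp p a *m (M z)^T + redp p b.

Lemma kappa_dot z a b y :
  (kappa z a b *m (r y)^T) 0 0 = (intdot (row_mx a b) (pairX z y))%:~R.
Proof.
rewrite /kappa mulmxDl -mulmxA -trmx_mul -ME !r_redp.
rewrite intdotE big_split_ord /= intrD !mxE; congr (_ + _).
  rewrite rmorph_sum /=; apply: eq_bigr => i _.
  by rewrite pairX_l row_mxEl !mxE intrM.
rewrite rmorph_sum /=; apply: eq_bigr => i _.
by rewrite pairX_r row_mxEr !mxE intrM.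
Qed.

Lemma kappaB z a b a' b' :
  kappa z (a - a') (b - b') = kappa z a b - kappa z a' b'.
Proof. by rewrite /kappa !redpB mulmxBl opprD addrACA. Qed.

(** Subtracting the two relations gives [a . r ((z - z') * y) = 0] for all [y]. If [z != z'], the
    products [(z - z') * y] fill [F], so [a], and then [b], vanishes modulo [p]; entries below [p]
    make both zero. *)
Lemma kappa_inj z z' (a b : 'rV[int]_n) :
  (forall i, `|a 0%R i| < p)%N -> (forall i, `|b 0%R i| < p)%N ->
  (a != 0) || (b != 0) -> kappa z a b = 0 -> kappa z' a b = 0 -> z = z'.
Proof.
move=> ap bp ab kz kz'; apply/eqP; apply: contraT => zz'.
have redp0 m : redp p (0 : 'rV_m) = 0 by rewrite /redp map_mx0.
have ra : redp p a = 0.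
  apply: trmx_inj; rewrite trmx0; apply/matrixP=> i j; rewrite (ord1 j) {j} mxE.
  have [y yE] : exists y, r ((z - z') * y) = delta_mx 0 i.
    have [x xE] := redp_surj (delta_mx 0 i : 'rV['F_p]_n).
    exists (ev w x / (z - z')).
    by rewrite mulrC divfK ?subr_eq0 // (coord_ev rP).
  have : r ((z - z') * y) *m (redp p a)^T = 0.
    apply: trmx_inj; rewrite trmx_mul trmxK trmx0.
    have e : r (z * y) = r ((z - z') * y) + r (z' * y).
      by rewrite -(coordD rP) mulrBl subrK.
    have -> : r ((z - z') * y) = r (z * y) - r (z' * y) by rewrite e addrK.
    rewrite !ME raddfB /= mulmxBr !trmx_mul !mulmxA.
    have k1 u : kappa u a b = 0 -> redp p a *m (M u)^T = - redp p b.
      by move/eqP; rewrite addr_eq0 => /eqP.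
    by rewrite !k1 // subrr.
  rewrite yE -rowE => /rowP/(_ 0); rewrite !mxE => ->.
  by [].
have rb : redp p b = 0 by move: kz; rewrite /kappa ra mul0mx add0r.
move: ab; suff [-> ->] : a = 0 /\ b = 0 by rewrite !eqxx.
by split; apply: (redp_inj p_pr); rewrite ?redp0 // => i; rewrite mxE subr0.
Qed.

(** The divisor [16 n] bounds a sum of [2n] products [rho i * h i] by [p / 8], the range required by
    [card_small_functionals]. *)
Definition dual_side (i : 'I_n) : nat := p %/ (16 * n * h i).
Notation rho := dual_side.

Lemma dual_side_mul i : (rho i * h i * (16 * n) <= p)%N.
Proof. by rewrite -mulnA [(h i * _)%N]mulnC leq_trunc_div. Qed.

Lemma dual_side_lt i : (rho i < p)%N.
Proof.
apply: ltn_Pdiv; last exact: prime_gt0.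
by have := h_gt0 i; nia.
Qed.

Definition dual_set j : {set F} :=
  [set z | `[< exists a b : 'rV[int]_n,
    [/\ forall i, (2 ^ j * `|a 0%R i| <= rho i)%N,
        forall i, (2 ^ j * `|b 0%R i| <= rho i)%N,
        (a != 0) || (b != 0) & kappa z a b = 0] >]].

(** By [kappa_inj] a nonzero dual vector determines [z]. As [kappa] depends on residues only, dual
    vectors can be counted modulo [p]. *)
Lemma card_dual_set j :
  (#|dual_set j| <= (\prod_i (2 * (rho i %/ 2 ^ j)).+1) ^ 2)%N.
Proof.
pose D := small_set (@redp p n) rho j.
apply: (@leq_trans (#|D| ^ 2)); last by rewrite leq_exp2r // card_small_set.
have /choice[ab abP] : forall z : F, exists ab : 'rV[int]_n * 'rV[int]_n,
    z \in dual_set j ->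
    [/\ forall i, (2 ^ j * `|ab.1 0%R i| <= rho i)%N,
        forall i, (2 ^ j * `|ab.2 0%R i| <= rho i)%N,
        (ab.1 != 0) || (ab.2 != 0) & kappa z ab.1 ab.2 = 0].
  move=> z; case: (boolP (z \in dual_set j)) => [|_]; last by exists (0, 0).
  by rewrite inE => /asboolP[a [b abP]]; exists (a, b).
have lt (x : 'rV[int]_n) : (forall i, (2 ^ j * `|x 0%R i| <= rho i)%N) ->
    forall i, (`|x 0%R i| < p)%N.
  move=> le i; apply: leq_ltn_trans (dual_side_lt i); apply: leq_trans (le i).
  by rewrite leq_pmull // expn_gt0.
pose g z := (redp p (ab z).1, redp p (ab z).2).
have g_inj : {in dual_set j &, injective g}.
  move=> z z' zG z'G; case=> ea eb.
  have [a1 b1 nz1 k1] := abP z zG; have [a2 b2 nz2 k2] := abP z' z'G.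
  apply: (kappa_inj (lt _ a1) (lt _ b1)) => //.
  by rewrite /kappa ea eb.
rewrite -(card_in_imset g_inj) -mulnn -cardsX.
apply/subset_leq_card/subsetP=> _ /imsetP[z /abP[az bz _ _] ->].
by rewrite in_setX /= !mem_small_set.
Qed.

(** Pairs of vectors with entries in [[0, rho i]]: two with the same functional differ by a dual
    vector in the dual box. *)
Let dualT : finType := (boxT (fun i => (rho i).+1) * boxT (fun i => (rho i).+1))%type.
Let vec (c : boxT (fun i => (rho i).+1)) : 'rV[int]_n := boxpt (fun=> -1) c.
Let pairT (t : dualT) : 'rV[int]_(n + n) := row_mx (vec t.1) (vec t.2).

Let vec_bounds c i : 0 <= vec c 0 i <= (rho i)%:Z.
Proof. by have := boxpt_bounds (fun=> -1) c i; rewrite /vec; lia. Qed.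

Let vec_abs c i : (`|vec c 0%R i| <= rho i)%N.
Proof. by have := vec_bounds c i; move: (vec c 0 i) => x; lia. Qed.

Let vec_dist c c' i : (`|vec c 0%R i - vec c' 0%R i| <= rho i)%N.
Proof.
have := vec_bounds c i; have := vec_bounds c' i.
by move: (vec c 0 i) (vec c' 0 i) => x y; lia.
Qed.

Let pairT_inj : injective pairT.
Proof. by case=> a b [a' b'] /eq_row_mx /= [/boxpt_inj -> /boxpt_inj ->]. Qed.

Let pairT_bounded T : bounded_on (dbl rho) pairT T.
Proof.
move=> t t' _ _; apply: forall_dbl => k.
  by rewrite dbl_lshift !row_mxEl vec_dist.
by rewrite dbl_rshift !row_mxEr vec_dist.
Qed.

Let intdot_small (u v : 'rV[int]_(n + n)) :
  (forall i, `|u 0%R i| <= dbl rho i)%N -> (forall i, `|v 0%R i| <= dbl h i)%N ->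
  (8 * `|intdot u v| <= p)%N.
Proof.
move=> ub vb.
have le := @intdot_le _ u v _ (fun i => leq_mul (ub i) (vb i)).
apply: (@leq_trans (8 * \sum_i dbl rho i * dbl h i)); first by rewrite leq_mul2l le.
rewrite sum_dbl; under eq_bigr do rewrite !dbl_lshift.
under [X in (_ * (_ + X))%N]eq_bigr do rewrite !dbl_rshift.
rewrite addnn -mul2n mulnA big_distrr /= -(leq_pmul2r n_gt0) big_distrl /=.
apply: (@leq_trans (\sum_(i < n) p)); last by rewrite sum_nat_const card_ord mulnC.
by apply: leq_sum => i _; apply: leq_trans (dual_side_mul i); lia.
Qed.

Let slice_bounded z y y' : y \in slice B z -> y' \in slice B z ->
  forall i, (`|(pairX z y - pairX z y')%R 0%R i| <= dbl h i)%N.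
Proof. by move=> yS y'S i; have := pairX_bounded yS y'S i; rewrite !mxE. Qed.

Let pairT_sub t t' :
  row_mx (vec t.1 - vec t'.1) (vec t.2 - vec t'.2) = pairT t - pairT t'.
Proof. by rewrite /pairT opp_row_mx add_row_mx. Qed.

Let dual_fibre z y0 : y0 \in slice B z -> exists T : {set dualT},
  [/\ ((\prod_i (rho i).+1) ^ 2 * #|slice B z| <= 4 * p ^ n * #|T|)%N,
      (forall t t', t \in T -> t' \in T ->
         kappa z (vec t.1 - vec t'.1) (vec t.2 - vec t'.2) = 0) &
      (forall t t' y y', t \in T -> t' \in T -> y \in slice B z -> y' \in slice B z ->
         intdot (pairT t - pairT t') (pairX z y - pairX z y') = 0)].
Proof.
move=> y0S; pose f (t : dualT) := kappa z (vec t.1) (vec t.2).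
have cardT : #|dualT| = ((\prod_i (rho i).+1) ^ 2)%N.
  by rewrite card_prod card_boxT mulnn.
have dualT_gt0 : (0 < #|dualT|)%N by rewrite cardT expn_gt0 prodn_gt0.
have [c cP] := large_fibre f dualT_gt0.
have small u y y' (a b : 'rV[int]_n) : u = row_mx a b ->
    (kappa z a b *m (r y - r y')^T) 0 0 = (intdot u (pairX z y - pairX z y'))%:~R.
  by move=> ->; rewrite raddfB /= mulmxBr mxE [X in _ + X]mxE !kappa_dot intdotBr intrB.
exists [set t | f t == c]; split.
- have inj : injective (fun y => r y - r y0).
    by move=> y y' /addIr /(coord_inj rP).
  (* Subtracting [r y0] replaces coordinates, which may be large, by differences, which [h]
     bounds. *)
  have := @card_small_functionals R p p_pr n (f @: dualT)
    [set r y - r y0 | y in slice B z].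
  rewrite (card_imset _ inj) => /(_ _) le; rewrite -cardT.
  apply: leq_trans (leq_mul cP (leqnn _)) _.
  rewrite mulnAC leq_mul2r; apply/orP; right; apply: le.
  move=> _ _ /imsetP[t _ ->] /imsetP[y yS ->].
  exists (intdot (pairT t) (pairX z y - pairX z y0)).
    apply: intdot_small (slice_bounded yS y0S).
    apply: forall_dbl => k.
      by rewrite dbl_lshift row_mxEl vec_abs.
    by rewrite dbl_rshift row_mxEr vec_abs.
  exact: small.
- by move=> t t'; rewrite !inE kappaB => /eqP e /eqP e'; rewrite /f in e e'; rewrite e e' subrr.
move=> t t' y y' tT t'T yS y'S.
have /eqP e : f t == c by move: tT; rewrite inE.
have /eqP e' : f t' == c by move: t'T; rewrite inE.
apply: (intr_Fp_eq0 p_pr).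
  by rewrite -pairT_sub -(small _ _ _ _ _ erefl) kappaB -/(f t) -/(f t') e e' subrr mul0mx mxE.
have := intdot_small (u := pairT t - pairT t') _ (slice_bounded yS y'S).
move=> /(_ _) le8; have p0 := prime_gt0 p_pr.
suff : (8 * `|intdot (pairT t - pairT t') (pairX z y - pairX z y')| <= p)%N by lia.
by apply: le8 => i; have := @pairT_bounded setT t t' (in_setT _) (in_setT _) i; rewrite !mxE.
Qed.

(** The three cases: the differences of pairs have rank at most [n]; the fibre [T] of [dual_fibre]
    has at most one element; or [T] has a level [k] of its own, and its differences are orthogonal
    to a space of dimension above [n]. *)
Lemma slice_dichotomy z j : (1 < #|slice B z|)%N ->
  separated_on (dbl h) (pairX z) (slice B z) (2 ^ j.+1) ->
  [\/ (#|slice B z| <= (2 * n * 2 ^ j.+1).+1 ^ n)%N,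
      ((\prod_i (rho i).+1) ^ 2 * #|slice B z| <= 4 * p ^ n)%N |
      exists k, [/\ (k <= trunc_log 2 p)%N, z \in dual_set k &
        ((\prod_i (rho i).+1) ^ 2 * #|slice B z| <=
           4 * p ^ n * (2 * n * 2 ^ k.+1).+1 ^ n.-1)%N]].
Proof.
move=> S1 sep.
have [y0 y0S] : exists y, y \in slice B z by apply/card_gt0P; apply: ltnW.
pose A : 'M[rat]_(#|F|, n + n) := \matrix_k
  (if enum_val k \in slice B z then diffQ (pairX z) (enum_val k) y0 else 0).
have AS y y' : y \in slice B z -> y' \in slice B z -> (diffQ (pairX z) y y' <= A)%MS.
  have A0 x : x \in slice B z -> (diffQ (pairX z) x y0 <= A)%MS.
    move=> xS; have -> : diffQ (pairX z) x y0 = row (enum_rank x) A.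
      by rewrite rowK enum_rankK xS.
    exact: row_sub.
  move=> yS y'S.
  have -> : diffQ (pairX z) y y' = diffQ (pairX z) y y0 - diffQ (pairX z) y' y0.
    by rewrite /diffQ -map_mxB; congr (map_mx _ _); rewrite opprB addrA subrK.
  by rewrite addmx_sub ?eqmx_opp ?A0.
have two_gt0 k : (0 < 2 ^ k)%N by rewrite expn_gt0.
have [rkA|rkA] := leqP (\rank A) n.
  constructor 1.
  apply: leq_trans (card_separated (A := row_base A) (two_gt0 _) (@pairX_bounded z) sep _) _.
    by move=> y y' yS y'S; rewrite eq_row_base AS.
  apply: (@leq_trans ((2 * n * 2 ^ j.+1).+1 ^ \rank A)).
    by apply: leq_expl; rewrite ltnS leq_mul2r leq_mul2l rkA !orbT.
  by rewrite leq_pexp2l.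
have [T [Tbig Tker Torth]] := dual_fibre y0S.
have [T1|T1] := leqP #|T| 1.
  constructor 2; apply: leq_trans Tbig _.
  by rewrite -[leqRHS]muln1 leq_mul2l T1 orbT.
constructor 3.
have hp : forall i, (dbl rho i <= p)%N.
  by apply: forall_dbl => k; rewrite ?dbl_lshift ?dbl_rshift ltnW // dual_side_lt.
have [k [kJ [t [t' [tT t'T tt' le]]] sepT]] :=
  exists_level hp (@pairT_bounded T) (in2W pairT_inj) T1.
exists k; split=> //.
  rewrite inE; apply/asboolP; exists (vec t.1 - vec t'.1), (vec t.2 - vec t'.2); split.
  - by move=> i; have := le (lshift n i); rewrite dbl_lshift !row_mxEl !mxE.
  - by move=> i; have := le (rshift n i); rewrite dbl_rshift !row_mxEr !mxE.
  - rewrite !subr_eq0 -negb_and; apply: contra tt' => /andP[/eqP e1 /eqP e2].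
    by apply/eqP/pairT_inj; rewrite /pairT e1 e2.
  - exact: Tker.
apply: leq_trans Tbig _; rewrite leq_mul2l; apply/orP; right.
apply: leq_trans (card_separated (A := row_base (kermx A^T)) (two_gt0 _)
  (@pairT_bounded T) sepT _) _.
  move=> u u' uT u'T; rewrite eq_row_base; apply/sub_kermxP/rowP=> l.
  rewrite mxE mxE; set v := enum_val l.
  have [vS|vS] := boolP (v \in slice B z); last first.
    by rewrite big1 // => i _; rewrite !mxE (negbTE vS) !mxE mulr0.
  have := Torth u u' v y0 uT u'T vS y0S; rewrite intdotE => /(congr1 (intr : int -> rat)).
  rewrite rmorph_sum /= mulr0z => e; apply: etrans e; apply: eq_bigr => i _.
  by rewrite !mxE -/v vS !mxE intrM.
(* The rank of [A] exceeds [n] in dimension [2n], so its orthogonal complement has rank below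
   [n]. *)
have rk : (\rank (kermx A^T) <= n.-1)%N by rewrite mxrank_ker mxrank_tr; lia.
apply: (@leq_trans ((2 * n * 2 ^ k.+1).+1 ^ \rank (kermx A^T))).
  by apply: leq_expl; rewrite ltnS leq_mul2r leq_mul2l (leq_trans rk) ?leq_pred ?orbT.
by rewrite leq_pexp2l.
Qed.

End Dichotomy.

(** * Degenerate ratios *)

(** From [2 m^2 < p] and [2 k^2 < p] follows [2 m k < p], while both products are at most [m k] in
    absolute value; so the congruence is an equality. *)
Lemma minor_eq0 p (p_pr : prime p) (a b c d : int) (m k : nat) :
  (2 * m ^ 2 < p)%N -> (2 * k ^ 2 < p)%N ->
  (`|a| <= m)%N -> (`|c| <= m)%N -> (`|b| <= k)%N -> (`|d| <= k)%N ->
  a%:~R * d%:~R = b%:~R * c%:~R :> 'F_p -> a * d = b * c.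
Proof.
move=> mp kp am cm bk dk e; apply: (intr_Fp_inj p_pr); first by rewrite !intrM.
have ad := leq_mul am dk; have bc := leq_mul bk cm.
rewrite -!abszM in ad bc.
have mk : (2 * (m * k) < p)%N by nia.
rewrite [(k * m)%N]mulnC in bc.
by move: (a * d) (b * c) (m * k)%N ad bc mk => x y t; lia.
Qed.

(* The hypotheses say that the linear forms [u1 + u2 T], [v1 + v2 T] and their
   primed versions satisfy [u v' = v u'] as polynomials; as [u] and [v] are
   coprime, [(u', v')] is proportional to [(u, v)]. *)
Lemma coprime_linear_forms (K : idomainType) (u1 u2 v1 v2 u1' u2' v1' v2' : K) :
  u1 * v1' = v1 * u1' -> u2 * v2' = v2 * u2' ->
  u1 * v2' + u2 * v1' = v1 * u2' + v2 * u1' -> u1 * v2 - u2 * v1 != 0 ->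
  [/\ u1 * u2' = u2 * u1', v1 * v2' = v2 * v1',
      u1 * v2' = v2 * u1' & u2 * v1' = v1 * u2'].
Proof.
move=> e1 e3 e2 d0.
have eu : u1 * u2' = u2 * u1'.
  apply: (mulfI d0); apply/eqP; rewrite -subr_eq0; apply/eqP.
  transitivity (u1 * u2 * (u1 * v2' + u2 * v1' - (v1 * u2' + v2 * u1'))
    - u1 ^+ 2 * (u2 * v2' - v2 * u2') - u2 ^+ 2 * (u1 * v1' - v1 * u1')); first by ring.
  by rewrite e1 e2 e3 !subrr !mulr0 !subr0.
have ev : v1 * v2' = v2 * v1'.
  apply: (mulfI d0); apply/eqP; rewrite -subr_eq0; apply/eqP.
  transitivity (v1 * v2 * (u1 * v2' + u2 * v1' - (v1 * u2' + v2 * u1'))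
    - v1 ^+ 2 * (u2 * v2' - v2 * u2') - v2 ^+ 2 * (u1 * v1' - v1 * u1')); first by ring.
  by rewrite e1 e2 e3 !subrr !mulr0 !subr0.
have e12 : u1 * v2' = v2 * u1'.
  apply/eqP; rewrite -subr_eq0 -sqrf_eq0; apply/eqP.
  transitivity ((u1 * u2' - u2 * u1') * (v1 * v2' - v2 * v1')
    - (u1 * v1' - v1 * u1') * (u2 * v2' - v2 * u2')
    + (u1 * v2' - v2 * u1') *
      (u1 * v2' + u2 * v1' - (v1 * u2' + v2 * u1'))); first by ring.
  by rewrite eu ev e1 e2 e3 !(subrr, mul0r, mulr0, subr0, addr0).
split=> //; move/eqP: e2; rewrite e12 addrC [RHS in _ == RHS]addrC => /eqP.
by rewrite [RHS]addrC => /addIr.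
Qed.

Definition prime_elt (F : finFieldType) (z : F) : Prop := exists c : int, z = c%:~R.

Section Degenerate.
Variables (F : finFieldType) (p n : nat) (w : n.-tuple F) (r : F -> 'rV['F_p]_n).
Hypotheses (p_pr : prime p) (rP : coordinates w r).
Variables (N : 'I_n -> int) (h : 'I_n -> nat).
Let B := box w N (fun i => (h i)%:Z).
Hypotheses (h_gt0 : forall i, (0 < h i)%N) (h_sqr : forall i, (2 * h i ^ 2 < p)%N).
Variable X : F -> 'rV[int]_n.
Hypotheses (XE : forall z, ev w (X z) = z)
  (XB : forall z, z \in B -> forall i, N i + 1 <= X z 0 i <= N i + (h i)%:Z).

Lemma evZ c x : ev w (c *: x) = c%:~R * ev w x.
Proof.
rewrite /ev mulr_sumr; apply: eq_bigr => i _.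
by rewrite mxE -[LHS]mulrzr intrM mulrCA mulrzr.
Qed.

Lemma redpZ c (x : 'rV[int]_n) : redp p (c *: x) = c%:~R *: redp p x.
Proof. by apply/rowP=> i; rewrite !mxE intrM. Qed.

Lemma prime_elt_coord (c : int) a b : ev w a = c%:~R * ev w b ->
  forall i, (a 0 i)%:~R = c%:~R * (b 0 i)%:~R :> 'F_p.
Proof.
rewrite -evZ => /(ev_eqE rP) /rowP e i.
by have := e i; rewrite redpZ !mxE.
Qed.

Lemma intr_Fp_F (s t : int) : s%:~R = t%:~R :> 'F_p -> s%:~R = t%:~R :> F.
Proof.
have E u : u%:~R = ev w (u *: X 1) by rewrite evZ XE mulr1.
by move=> e; rewrite !E; apply/(ev_eqE rP); rewrite !redpZ e.
Qed.

(** Fix all coordinates of [y] but the [l]-th. Coordinates of [z * y] are [c] times those of [y]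
    modulo [p], so in a pair only the two [l]-th coordinates vary, and proportionally modulo [p];
    [minor_eq0] makes this exact. *)
Lemma prime_elt_slice_le z j l : prime_elt z ->
  separated_on (dbl h) (pairX X z) (slice B z) (2 ^ j.+1) ->
  (#|slice B z| <= (\prod_(i | i != l) h i) * (2 * 2 ^ j.+1).+1)%N.
Proof.
move=> [c zc] sep.
apply: (@leq_card_fibers _ _ N h X _ [pred i | i != l]) => [y i|y0 y0S].
  by rewrite in_slice => /and3P[yB _ _] _; apply: XB.
set S' := [set y in _ | _].
have S'S : S' \subset slice B z by apply/subsetP=> y; rewrite inE => /andP[].
apply: (@card_separated_rank1 _ _ _ (dbl h) (pairX X z)).
- by rewrite expn_gt0.
- exact: bounded_onS S'S (@pairX_bounded _ _ _ N h X XB z).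
- exact: separated_onS S'S sep.
have X_eq y y' i : y \in S' -> y' \in S' -> i != l -> X y 0 i = X y' 0 i.
  rewrite inE => /andP[_ /forall_inP ey]; rewrite inE => /andP[_ /forall_inP ey'] il.
  by rewrite (eqP (ey i il)) (eqP (ey' i il)).
have zE y y' i : (X (z * y) 0 i - X (z * y') 0 i)%:~R =
    c%:~R * (X y 0 i - X y' 0 i)%:~R :> 'F_p.
  have := @prime_elt_coord c (X (z * y) - X (z * y')) (X y - X y') _ i.
  by rewrite !evB !XE -mulrBr zc !mxE; apply.
have zX_eq y y' i : y \in S' -> y' \in S' -> i != l -> X (z * y) 0 i = X (z * y') 0 i.
  move=> yS y'S il; have /subsetP sub := S'S.
  apply: (intr_Fp_inj p_pr).
    by apply/eqP; rewrite -subr_eq0 -intrB zE (X_eq y y' i) // subrr mulr0.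
  have [le _] := slice_dist XB i (sub _ yS) (sub _ y'S).
  exact: leq_ltn_trans le (h_lt h_gt0 h_sqr i).
have zero y y' k : y \in S' -> y' \in S' -> k != lshift n l -> k != rshift n l ->
    pairX X z y 0 k - pairX X z y' 0 k = 0.
  move=> yS y'S; move: k; apply: forall_dbl => k.
    rewrite !pairX_l (inj_eq (@lshift_inj _ _)) => kl _.
    by rewrite (zX_eq y y') // subrr.
  rewrite !pairX_r (inj_eq (@rshift_inj _ _)) => _ kl.
  by rewrite (X_eq y y') // subrr.
have main x y x' y' : x \in S' -> y \in S' -> x' \in S' -> y' \in S' ->
    (X (z * x) 0 l - X (z * y) 0 l) * (X x' 0 l - X y' 0 l) =
    (X x 0 l - X y 0 l) * (X (z * x') 0 l - X (z * y') 0 l).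
  move=> /(subsetP S'S) xS /(subsetP S'S) yS /(subsetP S'S) x'S /(subsetP S'S) y'S.
  have [? ?] := slice_dist XB l xS yS; have [? ?] := slice_dist XB l x'S y'S.
  apply: (minor_eq0 p_pr (h_sqr l) (h_sqr l)) => //.
  by rewrite !zE; ring.
move=> x y x' y' xS yS x'S y'S i k.
have [->|il] := eqVneq i (lshift n l).
  have [->|kl] := eqVneq k (lshift n l); first by rewrite mulrC.
  have [->|kr] := eqVneq k (rshift n l); first by rewrite !pairX_l !pairX_r main.
  by rewrite (zero x y k) // (zero x' y' k) // mulr0 mul0r.
have [->|ir] := eqVneq i (rshift n l).
  have [->|kr] := eqVneq k (rshift n l); first by rewrite mulrC.
  have [->|kl] := eqVneq k (lshift n l).
    by rewrite !pairX_l !pairX_r mulrC [RHS]mulrC main // mulrC.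
  by rewrite (zero x y k) // (zero x' y' k) // mulr0 mul0r.
by rewrite (zero x y i) // (zero x' y' i) // mulr0 mul0r.
Qed.

Definition prime_ratio_set j : {set F} := [set z in ratio_set w h j | `[< prime_elt z >]].

(** One coordinate where [b] is nonzero already gives [z] as a quotient of two residues. Which
    coordinate serves depends on [z], hence the largest side [h l]. *)
Lemma card_prime_ratio_set j l : (forall i, h i <= h l)%N ->
  (#|prime_ratio_set j| <= ((2 * (h l %/ 2 ^ j)).+1) ^ 2)%N.
Proof.
move=> hmax.
pose D := small_set (fun x : 'rV[int]_1 => (x 0 0)%:~R : 'F_p) (fun=> h l) j.
apply: (@leq_trans (#|D| ^ 2)); last first.
  rewrite leq_exp2r //; apply: leq_trans (card_small_set _ _ _) _.
  by rewrite big_ord1.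
have /choice[g gP] : forall z : F, exists q : 'F_p * 'F_p, z \in prime_ratio_set j ->
    [/\ q.1 \in D, q.2 \in D, q.2 != 0 &
      exists c : int, z = c%:~R /\ q.1 = c%:~R * q.2].
  move=> z; have [|_] := boolP (z \in prime_ratio_set j); last by exists (0, 0).
  rewrite inE => /andP[+ /asboolP[c zc]]; rewrite inE.
  move=> /exists_inP[a + /exists_inP[b + /andP[b0 /eqP zb]]].
  rewrite inE => /asboolP[x [xs xa]]; rewrite inE => /asboolP[y [ys yb]].
  have e : ev w x = c%:~R * ev w y by rewrite xa yb -zc zb.
  have [i yi] : exists i, y 0 i != 0.
    apply/rV0Pn; apply: contra_neq b0 => y0.
    by rewrite -yb y0 /ev big1 // => i _; rewrite mxE mulr0z.
  have memD (x' : 'rV[int]_n) : (forall i, (2 ^ j * `|x' 0%R i| <= h i)%N) ->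
      (x' 0 i)%:~R \in D.
    move=> xs'; have := @mem_small_set _ 1 (fun x : 'rV[int]_1 => (x 0 0)%:~R : 'F_p)
      (fun=> h l) j (const_mx (x' 0 i)).
    by rewrite mxE; apply=> k; rewrite mxE (leq_trans (xs' i)).
  exists ((x 0 i)%:~R, (y 0 i)%:~R) => _; split; [exact: memD|exact: memD| |].
    apply: contra_neq yi => /(intr_Fp_eq0 p_pr); apply.
    apply: leq_ltn_trans (h_lt h_gt0 h_sqr i); apply: leq_trans (ys i).
    by rewrite leq_pmull // expn_gt0.
  by exists c; split=> //; apply: prime_elt_coord.
have g_inj : {in prime_ratio_set j &, injective g}.
  move=> z z' zG z'G e; have [_ _ g0 [c [zc gc]]] := gP z zG.
  have [_ _ _ [c' [zc' gc']]] := gP z' z'G.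
  rewrite zc zc'; apply: intr_Fp_F.
  by apply: (mulIf g0); rewrite -gc [in RHS]e -gc' e.
rewrite -(card_in_imset g_inj) -mulnn -cardsX.
apply/subset_leq_card/subsetP=> _ /imsetP[z /gP[gD1 gD2 _ _] ->].
by rewrite [g z]surjective_pairing in_setX gD1 gD2.
Qed.

(* Once [2 ^ j] exceeds every side but the last, the differences occurring at
   level [j] are multiples of the last basis vector. *)
Lemma ratio_set_prime_elt z j l : (forall i, i != l -> (h i < 2 ^ j)%N) ->
  z \in ratio_set w h j -> prime_elt z.
Proof.
move=> hl; rewrite inE => /exists_inP[a + /exists_inP[b + /andP[b0 /eqP zb]]].
rewrite inE => /asboolP[x [xs xa]]; rewrite inE => /asboolP[y [ys yb]].
have evl (x' : 'rV[int]_n) : (forall i, (2 ^ j * `|x' 0%R i| <= h i)%N) ->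
    ev w x' = tnth w l * (x' 0 l)%:~R.
  move=> xs'; rewrite /ev (bigD1 l) //= big1 ?addr0 ?mulrzr // => i /hl hi.
  suff -> : x' 0 i = 0 by rewrite mulr0z.
  apply/eqP; rewrite -absz_eq0 -leqn0 -ltnS -(ltn_pmul2l (_ : 0 < 2 ^ j)%N) ?expn_gt0 //.
  by rewrite muln1 (leq_ltn_trans (xs' i)).
have [c cE] : exists c : int, (x 0 l)%:~R = c%:~R * (y 0 l)%:~R :> 'F_p.
  have yl : (y 0 l)%:~R != 0 :> 'F_p.
    apply: contra_neq b0 => /(intr_Fp_eq0 p_pr) y0; rewrite -yb evl // y0 ?mulr0 //.
    apply: leq_ltn_trans (h_lt h_gt0 h_sqr l); apply: leq_trans (ys l).
    by rewrite leq_pmull // expn_gt0.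
  exists (val ((x 0 l)%:~R / (y 0 l)%:~R : 'F_p))%:Z.
  by rewrite -[X in X * _]pmulrn natr_Zp divfK.
exists c; apply: (mulIf b0); rewrite zb -xa -yb !evl //.
rewrite mulrCA -intrM; congr (_ * _); apply: intr_Fp_F.
by rewrite intrM.
Qed.

End Degenerate.

(** * Cubic fields: ratios outside the prime field *)

Lemma ord3E (P : 'I_3 -> Prop) (i : 'I_3) :
  P ord0 -> P (lift ord0 ord0) -> P ord_max -> P i.
Proof.
move=> P0 P1 P2; case: i => [[|[|[|//]]] lt].
- by rewrite (_ : Ordinal lt = ord0) //; apply: val_inj.
- by rewrite (_ : Ordinal lt = lift ord0 ord0) //; apply: val_inj.
by rewrite (_ : Ordinal lt = ord_max) //; apply: val_inj.
Qed.

Lemma big_ord3 (T : Type) (idx : T) (op : Monoid.law idx) (f : 'I_3 -> T) :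
  \big[op/idx]_i f i = op (op (f ord0) (f (lift ord0 ord0))) (f ord_max).
Proof.
rewrite !big_ord_recl big_ord0 Monoid.mulm1 Monoid.mulmA; congr (op _ (f _)).
exact: val_inj.
Qed.

Section Cubic.
Variables (F : finFieldType) (p : nat) (w : 3.-tuple F) (r : F -> 'rV['F_p]_3).
Hypotheses (p_pr : prime p) (hF : #|F| = (p ^ 3)%N).
Hypothesis wB : Fp_basis p_pr hF w.
Hypothesis rP : coordinates w r.
Variables (N : 'I_3 -> int) (h : 'I_3 -> nat).
Let B := box w N (fun i => (h i)%:Z).
Hypotheses (h_gt0 : forall i, (0 < h i)%N) (h_sqr : forall i, (2 * h i ^ 2 < p)%N).
Variable X : F -> 'rV[int]_3.
Hypotheses (XE : forall z, ev w (X z) = z)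
  (XB : forall z, z \in B -> forall i, N i + 1 <= X z 0 i <= N i + (h i)%:Z).

Let i1 : 'I_3 := lift ord0 ord0.
Let i2 : 'I_3 := ord_max.

(** The identity [u v' = v u'] in [F] is a quadratic relation between the last two basis elements,
    so by [basis3_quadratic] its coefficients vanish modulo [p]. Then [coprime_linear_forms]
    applies: a zero determinant would put [z] in the prime field. *)
Let plane_proportional z (u v u' v' : 'rV[int]_3) :
  ~ prime_elt z -> redp p v != 0 ->
  u 0 ord0 = 0 -> v 0 ord0 = 0 -> u' 0 ord0 = 0 -> v' 0 ord0 = 0 ->
  ev w u = z * ev w v -> ev w u' = z * ev w v' ->
  forall i k : 'I_(3 + 3),
    (row_mx u v 0 i)%:~R * (row_mx u' v' 0 k)%:~R =
    (row_mx u v 0 k)%:~R * (row_mx u' v' 0 i)%:~R :> 'F_p.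
Proof.
move=> zF v0 u0 v00 u0' v0' e e'.
have ev2 (x : 'rV[int]_3) : x 0 ord0 = 0 ->
    ev w x = (x 0 i1)%:~R * tnth w i1 + (x 0 i2)%:~R * tnth w i2.
  by move=> x0; rewrite /ev big_ord3 /= x0 mulr0z add0r !mulrzl.
have quad : tnth w i1 ^+ 2 *~ (u 0 i1 * v' 0 i1 - v 0 i1 * u' 0 i1)
    + (tnth w i1 * tnth w i2) *~
      (u 0 i1 * v' 0 i2 + u 0 i2 * v' 0 i1 - (v 0 i1 * u' 0 i2 + v 0 i2 * u' 0 i1))
    + tnth w i2 ^+ 2 *~ (u 0 i2 * v' 0 i2 - v 0 i2 * u' 0 i2) = 0.
  transitivity (ev w u * ev w v' - ev w v * ev w u').
    rewrite !ev2 // -[_ ^+ 2 *~ _]mulrzl -[(_ * _) *~ _]mulrzl.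
    by rewrite -[X in _ + X]mulrzl !intrB !intrD !intrM; ring.
  by rewrite e e'; ring.
have i12 : i1 != i2 by [].
have [] := basis3_quadratic wB i12 quad.
rewrite !intrB !intrD !intrM => /eqP + /eqP + /eqP.
rewrite !subr_eq0 => /eqP m1 /eqP m12 /eqP m2.
have det0 : (u 0 i1)%:~R * (v 0 i2)%:~R - (u 0 i2)%:~R * (v 0 i1)%:~R != 0 :> 'F_p.
  apply/eqP => det; apply: zF.
  move/eqP: det; rewrite subr_eq0 => /eqP det.
  have pr k l : (u 0 k)%:~R * (v 0 l)%:~R = (v 0 k)%:~R * (u 0 l)%:~R :> 'F_p.
    elim/ord3E: k; elim/ord3E: l; rewrite ?u0 ?v00 ?mulr0z ?mulr0 ?mul0r //;
      first [by rewrite mulrC | by rewrite det mulrC | by rewrite -det mulrC].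
  have [k vk] : exists k, (v 0 k)%:~R != 0 :> 'F_p.
    by have /rV0Pn[k vk] := v0; exists k; move: vk; rewrite mxE.
  pose c : int := (val ((u 0 k)%:~R / (v 0 k)%:~R : 'F_p))%:Z.
  have cE : c%:~R = (u 0 k)%:~R / (v 0 k)%:~R :> 'F_p by rewrite -pmulrn natr_Zp.
  have uE : ev w u = c%:~R * ev w v.
    rewrite -evZ; apply/(ev_eqE rP); rewrite redpZ; apply/rowP=> l.
    by rewrite !mxE cE mulrAC pr mulrAC divff // mul1r.
  have evv0 : ev w v != 0.
    apply: contra_neq v0 => ev0; rewrite -(coord_ev rP) ev0.
    have -> : (0 : F) = ev w 0 by rewrite /ev big1 // => l _; rewrite mxE mulr0z.
    by rewrite (coord_ev rP) /redp map_mx0.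
  by exists c; apply: (mulIf evv0); rewrite -e uE.
have [mu mv m3 m4] := coprime_linear_forms m1 m2 m12 det0.
apply: forall_dbl => k; apply: forall_dbl => l; rewrite ?row_mxEl ?row_mxEr;
  elim/ord3E: k; elim/ord3E: l;
  rewrite ?u0 ?v00 ?u0' ?v0' ?mulr0z ?mulr0 ?mul0r // -/i1 -/i2 //;
  by rewrite mulrC // [RHS]mulrC.
Qed.

(** The first coordinates of [z * y] and [y] take at most [h ord0 ^ 2] values. Once they are fixed,
    differences avoid the first basis vector, and [plane_proportional] with [minor_eq0] makes them
    proportional. *)
Lemma cubic_slice_le z j : ~ prime_elt z ->
  separated_on (dbl h) (pairX X z) (slice B z) (2 ^ j.+1) ->
  (#|slice B z| <= h ord0 ^ 2 * (2 * 2 ^ j.+1).+1)%N.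
Proof.
move=> zF sep.
pose N2 (i : 'I_(3 + 3)) := match split i with inl k => N k | inr k => N k end.
pose I : {pred 'I_(3 + 3)} := [pred i | (i == lshift 3 ord0) || (i == rshift 3 ord0)].
have -> : (h ord0 ^ 2 = \prod_(i in I) dbl h i)%N.
  rewrite (bigD1 (lshift 3 ord0)) ?inE //= (bigD1 (rshift 3 ord0)) ?inE //=.
  rewrite big1 => [|i /andP[/andP[+ /negbTE e1] /negbTE e2]]; last by rewrite inE e1 e2.
  by rewrite dbl_lshift dbl_rshift muln1.
apply: (@leq_card_fibers _ _ N2 (dbl h) (pairX X z)) => [y i yS _|y0 y0S].
  move: yS; rewrite in_slice => /and3P[yB _ zyB]; move: i; apply: forall_dbl => k.
    rewrite pairX_l dbl_lshift /N2 -[lshift 3 k]/(unsplit (inl k)) unsplitK.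
    exact: XB zyB k.
  rewrite pairX_r dbl_rshift /N2 -[rshift 3 k]/(unsplit (inr k)) unsplitK.
  exact: XB yB k.
set S' := [set y in _ | _].
have S'S : S' \subset slice B z by apply/subsetP=> y; rewrite inE => /andP[].
apply: (@card_separated_rank1 _ _ _ (dbl h) (pairX X z)).
- by rewrite expn_gt0.
- exact: bounded_onS S'S (@pairX_bounded _ _ _ N h X XB z).
- exact: separated_onS S'S sep.
have X_eq y y' : y \in S' -> y' \in S' ->
    X (z * y) 0 ord0 = X (z * y') 0 ord0 /\ X y 0 ord0 = X y' 0 ord0.
  rewrite inE => /andP[_ /forall_inP ey]; rewrite inE => /andP[_ /forall_inP ey'].
  have Il : lshift 3 ord0 \in I by rewrite inE eqxx.
  have Ir : rshift 3 ord0 \in I by rewrite inE eqxx orbT.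
  have := eqP (ey _ Il); have := eqP (ey _ Ir); have := eqP (ey' _ Il).
  have := eqP (ey' _ Ir); rewrite !pairX_l !pairX_r => -> -> -> ->.
  by [].
move=> x y x' y' xS yS x'S y'S.
have [->|xy] := eqVneq x y; first by move=> i k; rewrite !subrr !mul0r.
have [[xy1 xy2] [xy1' xy2']] := (X_eq _ _ xS yS, X_eq _ _ x'S y'S).
have evX a b : ev w (X (z * a) - X (z * b)) = z * ev w (X a - X b).
  by rewrite !evB !XE mulrBr.
have v0 : redp p (X x - X y) != 0.
  apply: contra_neq xy; rewrite redpB => /eqP; rewrite subr_eq0 => /eqP.
  by move=> /(ev_eqE rP); rewrite !XE.
have sub0 (a b : 'rV[int]_3) : a 0 ord0 = b 0 ord0 -> (a - b) 0 ord0 = 0.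
  by rewrite !mxE => ->; rewrite subrr.
have main := plane_proportional zF v0 (sub0 _ _ xy1) (sub0 _ _ xy2)
  (sub0 _ _ xy1') (sub0 _ _ xy2') (evX _ _) (evX _ _).
have rowE a b i : row_mx (X (z * a) - X (z * b)) (X a - X b) 0 i =
    pairX X z a 0 i - pairX X z b 0 i.
  by rewrite /pairX; move: i; apply: forall_dbl => k;
    rewrite ?row_mxEl ?row_mxEr !mxE.
have hd : forall i, (2 * dbl h i ^ 2 < p)%N.
  by apply: forall_dbl => k; rewrite ?dbl_lshift ?dbl_rshift.
have bd := @pairX_bounded _ _ _ N h X XB z.
move: xS yS x'S y'S => /(subsetP S'S) xS /(subsetP S'S) yS /(subsetP S'S) x'S /(subsetP S'S) y'S.
move=> i k; apply: (minor_eq0 p_pr (hd i) (hd k)); try exact: bd.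
by rewrite -!rowE main.
Qed.

End Cubic.

(** * Summation over the levels *)

Lemma leq_scaled (h j : nat) : (2 ^ j <= h)%N ->
  ((2 * (h %/ 2 ^ j)).+1 * 2 ^ j <= 3 * h)%N.
Proof.
move=> jh; have := leq_trunc_div h (2 ^ j).
by move: (h %/ 2 ^ j)%N => q; move: (2 ^ j)%N jh => t; nia.
Qed.

Section Assembly.
Variables (R : realType) (F : finFieldType) (p n : nat) (w : n.-tuple F)
  (r : F -> 'rV['F_p]_n).
Hypotheses (p_pr : prime p) (rP : coordinates w r).
Variables (N : 'I_n -> int) (h : 'I_n -> nat).
Let B := box w N (fun i => (h i)%:Z).
Hypotheses (n_gt0 : (0 < n)%N) (h_gt0 : forall i, (0 < h i)%N)
  (h_sqr : forall i, (2 * h i ^ 2 < p)%N).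
Variables (i0 l : 'I_n).
Hypotheses (h_min : forall i, (h i0 <= h i)%N) (h_max : forall i, (h i <= h l)%N).
Variable X : F -> 'rV[int]_n.
Hypotheses (XE : forall z, ev w (X z) = z)
  (XB : forall z, z \in B -> forall i, N i + 1 <= X z 0 i <= N i + (h i)%:Z).
Variable M : F -> 'M['F_p]_n.
Hypothesis ME : forall z y, r (z * y) = r y *m M z.

Let P := (\prod_i h i)%N.
Let f z := #|slice B z|.
Let rho := dual_side p h.
(** The squares of [mP j] and [mD j] bound the numbers of primal and dual ratios at level [j], so
    the aim is [m * f z = O(P)]. *)
Let mP j := (\prod_i (2 * (h i %/ 2 ^ j)).+1)%N.
Let mD j := (\prod_i (2 * (rho i %/ 2 ^ j)).+1)%N.

Lemma ratio_set_level z j : z \in ratio_set w h j -> (2 ^ j <= h l)%N.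
Proof.
rewrite inE => /exists_inP[a _ /exists_inP[b + /andP[b0 _]]].
rewrite inE => /asboolP[y [ys yb]].
have [i yi] : exists i, y 0 i != 0.
  apply/rV0Pn; apply: contra_neq b0 => y0.
  by rewrite -yb y0 /ev big1 // => i _; rewrite mxE mulr0z.
apply: leq_trans (h_max i); apply: leq_trans (ys i).
by rewrite leq_pmulr // absz_gt0.
Qed.

Lemma dual_set_level z k : z \in dual_set h M k -> (2 ^ k <= rho i0)%N.
Proof.
rewrite inE => /asboolP[a [b [as_ bs ab _]]].
have main (x : 'rV[int]_n) : (forall i, (2 ^ k * `|x 0%R i| <= rho i)%N) -> x != 0 ->
    (2 ^ k <= rho i0)%N.
  move=> xs /rV0Pn[i xi]; apply: (@leq_trans (rho i)).
    by apply: leq_trans (xs i); rewrite leq_pmulr // absz_gt0.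
  by rewrite /rho /dual_side leq_div2l // ?muln_gt0 ?n_gt0 ?h_gt0 // leq_mul2l h_min orbT.
by case/orP: ab; apply: main.
Qed.

Let h_sqr_le i : (h i * h i <= p)%N.
Proof. by have := h_sqr i; rewrite expnS expn1; lia. Qed.

Let P_sqr_le : (P ^ 2 <= p ^ n)%N.
Proof.
rewrite /P -mulnn -big_split /=.
by rewrite -[X in (p ^ X)%N]card_ord -prod_nat_const leq_prod.
Qed.

Let K16 := ((16 * n) ^ n)%N.

Let dual_box_large : (p ^ n <= \prod_i (rho i).+1 * (K16 * P))%N.
Proof.
rewrite /K16 -[X in ((16 * n) ^ X)%N]card_ord -prod_nat_const /P.
rewrite -big_split -big_split /= -[X in (p ^ X)%N]card_ord -prod_nat_const.
apply: leq_prod => i _; apply: ltnW.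
by rewrite /rho /dual_side -ltn_divLR // muln_gt0 muln_gt0 n_gt0 h_gt0.
Qed.

Let pn2_gt0 : (0 < p ^ n * p ^ n)%N.
Proof. by rewrite muln_gt0 expn_gt0 prime_gt0. Qed.

Let dual_weight g :
  (p ^ n * p ^ n * g <= (\prod_i (rho i).+1) ^ 2 * g * (K16 ^ 2 * P ^ 2))%N.
Proof.
apply: leq_trans (leq_mul (leq_mul dual_box_large dual_box_large) (leqnn g)) _.
by rewrite -!mulnn; apply/eq_leq; ring.
Qed.

(** 15 serves prime ratios, [(15 n)^n] slices of rank at most [n], 45 the second primal alternative,
    and the last term the dual levels, with [108 = 27 * 4] from [dual_volume] and [dual_fibre]. *)
Definition level_const := (15 + (15 * n) ^ n + 45 + 108 * (5 * n) ^ n.-1 * K16 ^ 2)%N.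

Hypothesis primal_alternative : forall z j, ~ prime_elt z -> z \in ratio_set w h j ->
  separated_on (dbl h) (pairX X z) (slice B z) (2 ^ j.+1) ->
  (forall i, 2 ^ j <= h i)%N \/ (mP j * f z <= 45 * P)%N.
(** At a dual level [k], [|S_z|] is [O(P^2 2^(k (n - 1)) / p^n)]; this bound then makes
    [mD k * |S_z|] of order [P]. *)
Hypothesis dual_volume : forall k, (2 ^ k <= rho i0)%N ->
  (P * mD k * 2 ^ (k * n.-1) <= 27 * p ^ n)%N.

Let small_power a j : (0 < a)%N -> ((2 * a * 2 ^ j.+1).+1 <= 5 * a * 2 ^ j)%N.
Proof.
move=> a_gt0; have : (0 < a * 2 ^ j)%N by rewrite muln_gt0 a_gt0 expn_gt0.
by rewrite expnS; nia.
Qed.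

Let A1 j := [set z in prime_ratio_set w h j |
  ((2 * (h l %/ 2 ^ j)).+1 * f z <= level_const * P)%N].
Let A2 j := [set z in ratio_set w h j | (mP j * f z <= level_const * P)%N].
Let A3 j := [set z in dual_set h M j | (mD j * f z <= level_const * P)%N].

Lemma slice_cover z : (f z <= 4 * K16 ^ 2)%N \/
  exists j, (j <= trunc_log 2 p)%N /\
    exists2 A, A \in [:: A1 j; A2 j; A3 j] & z \in A.
Proof.
have [f1|f1] := leqP (f z) 1.
  by left; apply: leq_trans f1 _; rewrite muln_gt0 expn_gt0 expn_gt0 muln_gt0 n_gt0.
have [j [jJ zj sep]] := slice_level h_gt0 h_sqr XE XB f1.
(* In the prime field the count of ratios involves only the side [h l], which matches the rank-one
   bound of [prime_elt_slice_le]. *)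
have [zF|zF] := pselect (prime_elt z).
  right; exists j; split=> //; exists (A1 j); first by rewrite in_cons eqxx.
  have zj' : z \in prime_ratio_set w h j by rewrite inE zj; apply/asboolP.
  rewrite in_set zj' /=.
  have le := @prime_elt_slice_le _ _ _ _ _ p_pr rP N h h_gt0 h_sqr X XE XB z j l zF sep.
  apply: leq_trans (leq_mul (leqnn _) le) _.
  have e : P = (h l * \prod_(i | i != l) h i)%N by rewrite /P (bigD1 l).
  apply: (@leq_trans (15 * P)); last first.
    by rewrite leq_mul2r /level_const -!addnA leq_addr orbT.
  have le2 := leq_scaled (ratio_set_level zj).
  have le3 : ((2 * 2 ^ j.+1).+1 <= 5 * 2 ^ j)%N by have := @small_power 1 j isT.
  rewrite e; move: (\prod_(i | _) h i)%N => Q.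
  apply: (@leq_trans (((2 * (h l %/ 2 ^ j)).+1 * 2 ^ j) * (5 * Q))).
    apply: (@leq_trans ((2 * (h l %/ 2 ^ j)).+1 * (Q * (5 * 2 ^ j)))).
      by rewrite !leq_mul2l le3 !orbT.
    by apply/eq_leq; ring.
  apply: (@leq_trans (3 * h l * (5 * Q))); first by rewrite leq_mul2r le2 orbT.
  by apply/eq_leq; ring.
have [big|mid] := primal_alternative zF zj sep; last first.
  right; exists j; split=> //; exists (A2 j); first by rewrite !in_cons eqxx orbT.
  rewrite in_set zj /=; apply: leq_trans mid _; rewrite leq_mul2r; apply/orP; right.
  by rewrite /level_const -addnA [(15 + _ + _)%N]addnC -addnA leq_addr.
have [le|le|[k [kJ zk le]]] :=
  slice_dichotomy R p_pr rP n_gt0 h_gt0 XE XB ME f1 sep.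
- right; exists j; split=> //; exists (A2 j); first by rewrite !in_cons eqxx orbT.
  rewrite in_set zj /=.
  apply: leq_trans (leq_mul (leqnn _) (leq_trans le (leq_expl n (small_power j n_gt0)))) _.
  apply: (@leq_trans ((15 * n) ^ n * P)); last first.
    by rewrite leq_mul2r /level_const -!addnA addnCA leq_addr orbT.
  rewrite expnMn [((5 * n) ^ n * _)%N]mulnC mulnA.
  have -> : (mP j * (2 ^ j) ^ n = \prod_i ((2 * (h i %/ 2 ^ j)).+1 * 2 ^ j))%N.
    by rewrite big_split /= prod_nat_const card_ord.
  have le3 : (\prod_i ((2 * (h i %/ 2 ^ j)).+1 * 2 ^ j) <= 3 ^ n * P)%N.
    rewrite -[X in (3 ^ X)%N]card_ord -prod_nat_const /P -big_split /=.
    by apply: leq_prod => i _; apply: leq_scaled.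
  apply: leq_trans (leq_mul le3 (leqnn _)) _.
  by rewrite mulnAC -expnMn mulnA.
(* A trivial fibre forces a slice of bounded size: the dual box has volume at least [p^n / (K16 P)],
   and [P^2 <= p^n]. *)
- left; rewrite -(leq_pmul2l pn2_gt0).
  apply: leq_trans (dual_weight _) _.
  apply: leq_trans (leq_mul le (leqnn _)) _.
  apply: (@leq_trans (4 * p ^ n * (K16 ^ 2 * p ^ n))); first by rewrite !leq_mul.
  by apply/eq_leq; ring.
right; exists k; split=> //; exists (A3 k); first by rewrite !in_cons eqxx !orbT.
rewrite in_set zk /=.
apply: (@leq_trans (108 * (5 * n) ^ n.-1 * K16 ^ 2 * P)); last first.
  by rewrite leq_mul2r /level_const leq_addl orbT.
rewrite -(leq_pmul2l pn2_gt0) mulnCA.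
apply: leq_trans (leq_mul (leqnn _) (dual_weight _)) _.
have le2 := leq_trans le (leq_mul (leqnn _) (leq_expl n.-1 (small_power k n_gt0))).
apply: leq_trans (leq_mul (leqnn _) (leq_mul le2 (leqnn _))) _.
rewrite expnMn -expnM.
apply: (@leq_trans ((P * mD k * 2 ^ (k * n.-1)) * (4 * p ^ n * (5 * n) ^ n.-1 * K16 ^ 2 * P))).
  by rewrite -!mulnn; apply/eq_leq; ring.
apply: leq_trans (leq_mul (dual_volume (dual_set_level zk)) (leqnn _)) _.
by apply/eq_leq; ring.
Qed.

(** Small slices contribute at most [4 K16^2] times the sum of all [|S_z|], which is at most [P^2];
    each of the three classes of a level contributes at most [(level_const * P)^2]. *)
Lemma energy_bound :
  (mul_energy B <= (3 + 4 * K16 ^ 2 + 3 * level_const ^ 2) *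
    ((trunc_log 2 p).+1 * P ^ 2))%N.
Proof.
have cB : #|B| = P by apply: (card_box p_pr rP) => i; rewrite ltnW // h_lt.
have := mul_energy_le B; rewrite cB => /leq_trans; apply.
have sumf := sum_card_slice B; rewrite cB in sumf.
have := sum_sqr_levels (D := ((level_const * P) ^ 2)%N) (K := 3) slice_cover _ _.
move=> /(_ _ _) le.
have {}le : (\sum_z f z ^ 2 <= 4 * K16 ^ 2 * (\sum_z f z) +
    (trunc_log 2 p).+1 * (3 * (level_const * P) ^ 2))%N.
  apply: le => // j A; rewrite !inE => /or3P[]/eqP ->.
  - apply: (@sum_sqr_class _ _ _ ((2 * (h l %/ 2 ^ j)).+1)); last first.
      by move=> z; rewrite in_set => /andP[].
    apply: leq_trans (@card_prime_ratio_set _ _ _ _ _ p_pr rP h h_gt0 h_sqr X XE j l h_max).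
    by apply/subset_leq_card/subsetP=> z; rewrite in_set => /andP[].
  - apply: (@sum_sqr_class _ _ _ (mP j)); last first.
      by move=> z; rewrite in_set => /andP[].
    apply: leq_trans (card_ratio_set w h j).
    by apply/subset_leq_card/subsetP=> z; rewrite in_set => /andP[].
  apply: (@sum_sqr_class _ _ _ (mD j)); last first.
    by move=> z; rewrite in_set => /andP[].
  apply: leq_trans (card_dual_set p_pr rP n_gt0 h_gt0 ME j).
  by apply/subset_leq_card/subsetP=> z; rewrite in_set => /andP[].
apply: leq_trans (leq_add (leqnn _) le) _.
apply: (@leq_trans (3 * P ^ 2 + (4 * K16 ^ 2 * P ^ 2 +
    (trunc_log 2 p).+1 * (3 * (level_const * P) ^ 2)))).
  by rewrite leq_add2l leq_add2r leq_mul2l sumf orbT.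
rewrite expnMn; move: (level_const ^ 2)%N (K16 ^ 2)%N (P ^ 2)%N (trunc_log 2 p).
by move=> a b c t; nia.
Qed.
End Assembly.

(** * Volume of the shrunk dual box *)

(** The first dual side is at least [2 ^ k] and absorbs this factor; the other side meets its bound
    [3 p] even if its quotient rounds to 0. *)
Lemma dual_volume2 p (h : 'I_2 -> nat) k : prime p ->
  (forall i, 0 < h i)%N -> (forall i, 2 * h i ^ 2 < p)%N ->
  (2 ^ k <= dual_side p h ord0)%N ->
  (\prod_i h i * (\prod_i (2 * (dual_side p h i %/ 2 ^ k)).+1) * 2 ^ (k * 1) <=
   27 * p ^ 2)%N.
Proof.
move=> p_pr h_gt0 h_sqr tk.
have hp i : (dual_side p h i * h i <= p)%N.
  by apply: leq_trans (dual_side_mul p h i); rewrite leq_pmulr.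
have hlt i := h_lt h_gt0 h_sqr i.
have qt i := leq_trunc_div (dual_side p h i) (2 ^ k).
have t_gt0 : (0 < 2 ^ k)%N by rewrite expn_gt0.
rewrite !big_ord_recl !big_ord0 muln1 !muln1.
set j1 := lift ord0 ord0; move: (hp ord0) (hp j1) (hlt j1) (qt ord0) (qt j1) tk t_gt0.
move: (dual_side p h ord0 %/ 2 ^ k)%N (dual_side p h j1 %/ 2 ^ k)%N.
move: (2 ^ k)%N (dual_side p h ord0) (dual_side p h j1).
move: (h ord0) (h j1) => a0 a1 t r0 r1 q0 q1 hp0 hp1 a1p qt0 qt1 tk t0.
have le0 : (a0 * (2 * q0).+1 * t <= 3 * p)%N by nia.
have le1 : (a1 * (2 * q1).+1 <= 3 * p)%N by nia.
have := leq_mul le0 le1; rewrite -mulnn; nia.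
Qed.

(** The first side absorbs one factor [2 ^ k]. When the other two are expanded with the second
    factor, the term without quotients is [h_1 h_2 2^k <= p^2], because [h_1 h_2 <= p] and
    [2^k <= p]; the other terms use [h_i q_i 2^k <= p]. *)
Lemma dual_volume3 p (h : 'I_3 -> nat) k : prime p ->
  (forall i, 0 < h i)%N -> (forall i, 2 * h i ^ 2 < p)%N ->
  (2 ^ k <= dual_side p h ord0)%N ->
  (\prod_i h i * (\prod_i (2 * (dual_side p h i %/ 2 ^ k)).+1) * 2 ^ (k * 2) <=
   27 * p ^ 3)%N.
Proof.
move=> p_pr h_gt0 h_sqr tk.
have hp i : (dual_side p h i * h i <= p)%N.
  by apply: leq_trans (dual_side_mul p h i); rewrite leq_pmulr.
have hlt i := h_lt h_gt0 h_sqr i.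
have qt i := leq_trunc_div (dual_side p h i) (2 ^ k).
have t_gt0 : (0 < 2 ^ k)%N by rewrite expn_gt0.
have rp : (dual_side p h ord0 <= p)%N by apply: leq_trans (hp ord0); rewrite leq_pmulr.
rewrite expnM !big_ord3 /=; set j1 := lift ord0 ord0; set j2 := ord_max.
have h12 : (h j1 * h j2 <= p)%N.
  by have := h_sqr j1; have := h_sqr j2; nia.
move: (hp ord0) (hp j1) (hp j2) (hlt j1) (hlt j2) h12 (qt ord0) (qt j1) (qt j2) rp tk t_gt0.
move: (dual_side p h ord0 %/ 2 ^ k)%N (dual_side p h j1 %/ 2 ^ k)%N (dual_side p h j2 %/ 2 ^ k)%N.
move: (2 ^ k)%N (dual_side p h ord0) (dual_side p h j1) (dual_side p h j2).
move: (h ord0) (h j1) (h j2) => a0 a1 a2 t r0 r1 r2 q0 q1 q2.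
move=> hp0 hp1 hp2 a1p a2p h12 qt0 qt1 qt2 rp tk t0.
have le0 : (a0 * (2 * q0).+1 * t <= 3 * p)%N by nia.
have b1 : (a1 * q1 * t <= p)%N by nia.
have b2 : (a2 * q2 * t <= p)%N by nia.
have c1 : (a1 * q1 <= p)%N by nia.
have le1 : (a1 * (2 * q1).+1 * (a2 * (2 * q2).+1) * t <= 9 * (p * p))%N.
  have d1 := leq_mul c1 b2; have d2 := leq_mul b1 (ltnW a2p).
  have d3 := leq_mul b2 (ltnW a1p); have d4 := leq_mul h12 (leq_trans tk rp).
  have -> : (a1 * (2 * q1).+1 * (a2 * (2 * q2).+1) * t =
    4 * (a1 * q1 * (a2 * q2 * t)) + 2 * (a1 * q1 * t * a2) + 2 * (a2 * q2 * t * a1)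
     + a1 * a2 * t)%N by ring.
  by lia.
apply: (@leq_trans (3 * p * (9 * (p * p)))); last by apply/eq_leq; ring.
by apply: leq_trans (leq_mul le0 le1); apply/eq_leq; ring.
Qed.

(** * The energy in degrees 2 and 3 *)

Section Energy.
Variables (R : realType) (F : finFieldType) (p : nat) (p_pr : prime p).

Definition energy_const n :=
  (3 + 4 * ((16 * n) ^ n) ^ 2 + 3 * level_const n ^ 2)%N.

Lemma energy_bound2 (hF : #|F| = (p ^ 2)%N) (w : 2.-tuple F)
    (N : 'I_2 -> int) (h : 'I_2 -> nat) :
  Fp_basis p_pr hF w -> (forall i, 0 < h i)%N -> (forall i, 2 * h i ^ 2 < p)%N ->
  (forall i j : 'I_2, (i <= j)%N -> (h i <= h j)%N) ->
  (mul_energy (box w N (fun i => (h i)%:Z)) <=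
    energy_const 2 * ((trunc_log 2 p).+1 * (\prod_i h i) ^ 2))%N.
Proof.
move=> wB h_gt0 h_sqr h_mono.
have [r rP] := basis_coordinates wB.
have [X [XE XB]] := box_coords rP N h.
have [M ME] := coord_mulmx rP.
apply: (energy_bound R p_pr rP isT h_gt0 h_sqr (i0 := ord0) (l := ord_max) _ _ XE XB ME).
- by move=> i; apply: h_mono.
- by move=> i; apply: h_mono; rewrite -ltnS.
(* A level above the smaller side would put [z] in the prime field. *)
- move=> z j zF zj _; left => i.
  suff h0 : (2 ^ j <= h ord0)%N by apply: leq_trans h0 (h_mono _ _ _).
  rewrite leqNgt; apply/negP => h0; apply: zF.
  apply: (ratio_set_prime_elt p_pr rP h_gt0 h_sqr XE (l := ord_max) _ zj).
  by move=> i'; case: i' => [[|[|//]] lt] // _; apply: leq_trans h0; rewrite ltnS h_mono.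
by move=> k; apply: dual_volume2.
Qed.

Lemma energy_bound3 (hF : #|F| = (p ^ 3)%N) (w : 3.-tuple F)
    (N : 'I_3 -> int) (h : 'I_3 -> nat) :
  Fp_basis p_pr hF w -> (forall i, 0 < h i)%N -> (forall i, 2 * h i ^ 2 < p)%N ->
  (forall i j : 'I_3, (i <= j)%N -> (h i <= h j)%N) ->
  (mul_energy (box w N (fun i => (h i)%:Z)) <=
    energy_const 3 * ((trunc_log 2 p).+1 * (\prod_i h i) ^ 2))%N.
Proof.
move=> wB h_gt0 h_sqr h_mono.
have [r rP] := basis_coordinates wB.
have [X [XE XB]] := box_coords rP N h.
have [M ME] := coord_mulmx rP.
apply: (energy_bound R p_pr rP isT h_gt0 h_sqr (i0 := ord0) (l := ord_max) _ _ XE XB ME).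
- by move=> i; apply: h_mono.
- by move=> i; apply: h_mono; rewrite -ltnS.
- move=> z j zF zj sep.
  (* Above the middle side only multiples of the last basis vector remain, and [z] would lie in the
     prime field. *)
  have h1 : (2 ^ j <= h (lift ord0 ord0))%N.
    rewrite leqNgt; apply/negP => h1; apply: zF.
    apply: (ratio_set_prime_elt p_pr rP h_gt0 h_sqr XE (l := ord_max) _ zj).
    by move=> i'; case: i' => [[|[|[|//]]] lt] // _; apply: leq_trans h1; rewrite ltnS h_mono.
  have h2 : (2 ^ j <= h ord_max)%N by apply: leq_trans h1 (h_mono _ _ _).
  have [h0|h0] := leqP (2 ^ j) (h ord0).
    by left=> i; apply: leq_trans h0 (h_mono _ _ _).
  (* Only the first side is below [2 ^ j], and it contributes a factor 1 to the count. The slice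
     bound becomes [5 h_0 4^j], and the other two sides give a factor 3 each, so 45 in all. *)
  right=> /=.
  have le := cubic_slice_le wB rP h_sqr XE XB zF sep.
  apply: leq_trans (leq_mul (leqnn _) le) _.
  have := leq_scaled h1; have := leq_scaled h2.
  rewrite !big_ord3 /= [(h ord0 %/ _)%N]divn_small // muln0 mul1n.
  have t0 : (0 < 2 ^ j)%N by rewrite expn_gt0.
  rewrite [(2 ^ j.+1)%N]expnS; move: (h (lift ord0 ord0) %/ 2 ^ j)%N (h ord_max %/ 2 ^ j)%N.
  move: (2 ^ j)%N h0 t0 => t h0 t0 q1 q2 le2 le1.
  have le3 : (h ord0 ^ 2 * (2 * (2 * t)).+1 <= 5 * h ord0 * (t * t))%N by nia.
  apply: leq_trans (leq_mul (leqnn _) le3) _.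
  apply: (@leq_trans (5 * h ord0 * (((2 * q1).+1 * t) * ((2 * q2).+1 * t)))).
    by apply/eq_leq; ring.
  apply: leq_trans (leq_mul (leqnn _) (leq_mul le1 le2)) _.
  by apply/eq_leq; ring.
by move=> k; apply: dual_volume3.
Qed.

End Energy.

(** * From levels to the power of the logarithm *)

(** The number of levels is at most [2 ln p / ln 2], and the remaining factor [(ln p / ln 2)^2] is
    at least 1. *)
Lemma trunc_log2_le_ln (R : realType) p : (2 <= p)%N ->
  (trunc_log 2 p).+1%:R <= 2 / ln 2 ^+ 3 * ln (p%:R : R) ^+ 3.
Proof.
move=> p2; set J := trunc_log 2 p; set l := ln (2 : R).
have l_gt0 : 0 < l by rewrite ln_gt0 // ltr1n.
have J_gt0 : (0 < J)%N by apply: trunc_log_max.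
have p_gt0 : (0 < p)%N by apply: ltnW.
have lp : l <= ln (p%:R : R) by rewrite ler_ln ?posrE ?ltr0n // ler_nat.
have Jlp : J%:R * l <= ln (p%:R : R).
  rewrite mulr_natl -lnXn // ler_ln ?posrE ?exprn_gt0 ?ltr0n //.
  by rewrite -natrX ler_nat trunc_logP.
have J2 : J.+1%:R <= 2 * J%:R :> R by rewrite -natrM ler_nat; lia.
rewrite mulrAC ler_pdivlMr ?exprn_gt0 //.
move: (ln (p%:R : R)) lp Jlp => L lp Jlp.
have L_gt0 : 0 < L by apply: lt_le_trans lp.
have lL : l ^+ 2 <= L ^+ 2 by rewrite ler_sqr // nnegrE ltW.
have JL : J.+1%:R * l <= 2 * L by nra.
rewrite [l ^+ 3]exprS [L ^+ 3]exprS mulrA [leRHS]mulrA.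
apply: ler_pM JL lL; last exact: sqr_ge0.
by rewrite mulr_ge0 ?ler0n // ltW.
Qed.

Theorem mainTheorem2 (R : realType) :
  exists2 C : R, 0 < C &
    forall (n : nat) (p : nat) (F : finFieldType)
      (hn : n = 2%N \/ n = 3%N) (hp : prime p) (hF : #|F| = (p ^ n)%N)
      (w : n.-tuple F) (N H : 'I_n -> int),
      Fp_basis hp hF w ->
      (forall i, 1 <= H i) ->
      (forall i j : 'I_n, (i <= j)%N -> H i <= H j) ->
      (forall i, (H i)%:~R < Num.sqrt (p%:R / 2 : R)) ->
      (mul_energy (box w N H))%:R
        <= C * #|box w N H|%:R ^+ 2 * ln (p%:R : R) ^+ 3.
Proof.
have l_gt0 : 0 < ln (2 : R) by rewrite ln_gt0 // ltr1n.
(* The sum of the constants for [n = 2] and [n = 3] serves both; the second factor comes from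
   [trunc_log2_le_ln]. *)
exists ((energy_const 2 + energy_const 3)%:R * (2 / ln 2 ^+ 3)).
  by rewrite mulr_gt0 ?divr_gt0 ?exprn_gt0 // ltr0n addn_gt0 /energy_const !addSn.
move=> n p F hn hp hF w N H wB H_ge1 H_mono H_lt.
pose h i := `|H i|%N.
have hE i : H i = (h i)%:Z by have := H_ge1 i; rewrite /h; lia.
have {H_ge1} h_gt0 i : (0 < h i)%N by have := H_ge1 i; rewrite hE; lia.
have {H_mono} h_mono (i j : 'I_n) : (i <= j)%N -> (h i <= h j)%N.
  by move=> /H_mono; rewrite !hE lez_nat.
have {H_lt} h_sqr i : (2 * h i ^ 2 < p)%N.
  have := H_lt i; rewrite hE -pmulrn => lt.
  have p2_ge0 : 0 <= p%:R / 2 :> R by rewrite divr_ge0 ?ler0n.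
  have : (h i)%:R ^+ 2 < p%:R / 2 :> R.
    by rewrite -(sqr_sqrtr p2_ge0) ltr_pXn2r ?nnegrE ?sqrtr_ge0.
  by rewrite ltr_pdivlMr // -natrX -natrM ltr_nat mulnC.
have -> : H = fun i => (h i)%:Z by apply/funext => i; rewrite hE.
have [r rP] := basis_coordinates wB.
rewrite (card_box hp rP) => [|i]; last by rewrite ltnW // (h_lt h_gt0 h_sqr).
have le : (mul_energy (box w N (fun i => (h i)%:Z)) <=
    (energy_const 2 + energy_const 3) * ((trunc_log 2 p).+1 * (\prod_i h i) ^ 2))%N.
  case: hn => n_eq; move: w N H h hE h_gt0 h_mono h_sqr hF wB r rP; rewrite n_eq;
    move=> w N H h _ h_gt0 h_mono h_sqr hF wB _ _.
    apply: leq_trans (energy_bound2 R N wB h_gt0 h_sqr h_mono) _.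
    by rewrite leq_mul2r leq_addr orbT.
  apply: leq_trans (energy_bound3 R N wB h_gt0 h_sqr h_mono) _.
  by rewrite leq_mul2r leq_addl orbT.
have le2 := trunc_log2_le_ln R (prime_gt1 hp).
apply: (@le_trans _ _ (((energy_const 2 + energy_const 3) *
  ((trunc_log 2 p).+1 * (\prod_i h i) ^ 2))%N%:R)); first by rewrite ler_nat.
have key (K T Q c L : R) : 0 <= K -> 0 <= Q -> T <= c * L ->
    K * (T * Q) <= K * c * Q * L.
  move=> K0 Q0 TL; have -> : K * c * Q * L = K * (c * L * Q) by ring.
  by rewrite ler_wpM2l // ler_wpM2r.
by rewrite natrM natrM natrX; apply: key => //; apply: sqr_ge0.
Qed.
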